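(* Let $m\in(0,1]$, let $\mathtt l,\mathtt r\in\mathbb R$ satisfy $\mathtt l<\mathtt r$, and assume that $f(\cdot)>m>0$ on $[\mathtt l,\mathtt r]$. Assume also that $t_0>0$ and that $K:\mathbb R\to\mathbb R$ is a square-integrable, symmetric, kernel function. Then, for every $t\in(0,T]$ (and every $\mathbf h=(h_1,h_2)\in(0,1]^2$, $\ell\in(0,1]$, $N\in\mathbb N^*$), $$\mathbb E(\|\widehat p_{\mathbf h,\ell,t}-p_t\|_{[\mathtt l,\mathtt r]\times\mathbb R}^2)\leqslant\frac{16}{m^2}\max\{1,\mathfrak m_p(t_0,T)\}\left(\|s_{\mathbf h,t}-s_t\|^2+\|f_\ell-f\|^2+\frac{\|K\|^4}{Nh_1h_2}+\frac{\|K\|^2}{N\ell}\right)$$ and $$\mathbb E(\|\widehat p_{\mathbf h,\ell,t}-p_t\|_{1\otimes f,[\mathtt l,\mathtt r]\times\mathbb R}^2)\leqslant\frac{16}{m^2}\max\{1,\mathfrak m_p(t_0,T)\}\,\mathfrak m_f(t_0,T)\left(\frac1m\|s_{\mathbf h,t}-s_t\|_{1\otimes f}^2+\|f_\ell-f\|^2+\frac{\|K\|^4}{Nh_1h_2}+\frac{\|K\|^2}{N\ell}\right),$$ where $s_{\mathbf h,t}:=Q_{\mathbf h}\star s_t$ and $f_\ell:=K_\ell\star f$.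
   Context: Let $T>0$, $t_0\in[0,T)$, $x_0\in\mathbb R$. Let $X=(X_t)_{t\in[0,2T]}$ be the unique strong solution of $dX_t=b(X_t)dt+\sigma(X_t)dW_t$, $X_0=x_0$, where $W$ is a Brownian motion, $b,\sigma\in C^1(\mathbb R)$ with $b',\sigma'$ bounded, and there exist $\alpha,A>0$ such that $\alpha\leqslant|\sigma(x)|\leqslant\alpha+A$ for all $x\in\mathbb R$. Under these assumptions $X$ is a homogeneous Markov process with a transition density: $p_t(x,\cdot)$ is the conditional density of $X_{s+t}$ given $X_s=x$. Set $$f(\cdot):=\frac1{T-t_0}\int_{t_0}^Tp_s(x_0,\cdot)ds,\qquad s_t(x,y):=f(x)p_t(x,y).$$ There are positive constants $\overline{\mathfrak c}_T$ and $\mathfrak c_T$, not depending on $t_0$, such that $$\sup_{(t,x,y)\in[t_0,T]\times\mathbb R^2}p_t(x,y)\leqslant\frac{\overline{\mathfrak c}_T}{\sqrt{t_0}}=:\mathfrak m_p(t_0,T),\qquad\|f\|_\infty\leqslant\frac{2\mathfrak c_T}{\sqrt{T-t_0}}=:\mathfrak m_f(t_0,T);$$ such constants are fixed. Let $X^1,\dots,X^N$ be independent copies of $X$ (solutions of the same equation driven by independent Brownian motions). A kernel function is an integrable function $K:\mathbb R\to\mathbb R$ with $\int K=1$. For $h\in(0,1]$, $K_h(\cdot):=\frac1hK(\cdot/h)$; for $\mathbf h=(h_1,h_2)\in(0,1]^2$, $Q_{\mathbf h}(x,y):=K_{h_1}(x)K_{h_2}(y)$. Define $$\widehat s_{\mathbf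 h,t}(x,y):=\frac1{N(T-t_0)}\sum_{i=1}^N\int_{t_0}^TQ_{\mathbf h}(X^i_s-x,X^i_{s+t}-y)ds,\qquad\widehat f_\ell(x):=\frac1{N(T-t_0)}\sum_{i=1}^N\int_{t_0}^TK_\ell(X^i_s-x)ds,$$ and the Nadaraya-Watson estimator $$\widehat p_{\mathbf h,\ell,t}(x,y):=\frac{\widehat s_{\mathbf h,t}(x,y)}{\widehat f_\ell(x)}\mathbf 1_{\widehat f_\ell(x)>m/2},\qquad(x,y)\in\mathbb R^2.$$ Notation: $\|\cdot\|$ is the usual norm of $\mathbb L^2(\mathbb R)$ or $\mathbb L^2(\mathbb R^2)$; $\|g\|_{1\otimes f}^2:=\int_{\mathbb R^2}g(x,y)^2f(y)dxdy$; $\|g\|_{[\mathtt l,\mathtt r]\times\mathbb R}^2:=\int_{[\mathtt l,\mathtt r]\times\mathbb R}g(x,y)^2dxdy$; $\|g\|_{1\otimes f,[\mathtt l,\mathtt r]\times\mathbb R}^2:=\int_{[\mathtt l,\mathtt r]\times\mathbb R}g(x,y)^2f(y)dxdy$; $\|\cdot\|_\infty$ is the sup norm; $\star$ is convolution.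
   Formalization: For t < t_0 the constant m_p(t_0,T) is replaced by m_p(min(t_0,t),T), since m_p(t_0,T) bounds p_t only for t ≥ t_0 and the stated inequalities fail as t → 0 (e.g. for Brownian motion); for t in [t_0,T] the bounds are as stated. *)

(* Defs.v *)
From HB Require Import structures.
From mathcomp Require Import all_boot all_order all_algebra.
From mathcomp Require Import all_classical all_reals all_analysis.
Set Implicit Arguments.
Unset Strict Implicit.
Unset Printing Implicit Defensive.
Import Order.TTheory GRing.Theory Num.Theory.
Import numFieldNormedType.Exports.
Local Open Scope classical_set_scope.
Local Open Scope ring_scope.

Section processes.
Context {R : realType} {d : measure_display} {Omega : measurableType d}.
Variable P : probability Omega R.
Implicit Types (W X Y : R -> {RV P >-> R}) (F : R -> set (set Omega)).

(* A process on the time interval [0, S] is a family of random variables indexed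
   by the whole real line, of which only the indices in [0, S] are used. *)

Definition sub_measurable (G : set (set Omega)) (Z : Omega -> R) :=
  forall B : set R, measurable B -> G (Z @^-1` B).

Definition adapted (S : R) F X :=
  forall t, 0 <= t <= S -> sub_measurable (F t) (X t).

Definition events_before Y (s : R) : set (set Omega) :=
  [set E | exists u (B : set R), [/\ 0 <= u <= s, measurable B & E = Y u @^-1` B]].

Definition natural_filtration Y (s : R) : set (set Omega) :=
  <<s events_before Y s >>.

Definition augmented_filtration Y (s : R) : set (set Omega) :=
  <<s events_before Y s `|` [set E | measurable E /\ P E = 0%E] >>.

Definition continuous_paths (S : R) X :=
  {ae P, forall w, {within `[0, S], continuous (fun t => X t w)}}.

(* Requiring the product rule for the full family only is enough,
   since setT belongs to each sigma-algebra G i. *)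
Definition independent (N : nat) (G : 'I_N -> set (set Omega)) :=
  forall E : 'I_N -> set Omega, (forall i, G i (E i)) ->
    (P (\bigcap_i E i) = \prod_(i < N) P (E i))%E.

Definition same_law (S : R) X Y :=
  forall (n : nat) (u : 'I_n -> R) (B : 'I_n -> set R),
    (forall k, 0 <= u k <= S) -> (forall k, measurable (B k)) ->
    P (\bigcap_k (X (u k) @^-1` B k)) = P (\bigcap_k (Y (u k) @^-1` B k)).

(* The second argument of normal_prob is the standard deviation. *)
Record brownian_motion (S : R) W : Prop := BrownianMotion {
  bm_start : {ae P, forall w, W 0 w = 0} ;
  bm_continuous : continuous_paths S W ;
  bm_gaussian : forall s t : R, 0 <= s -> s < t -> t <= S ->
    forall B : set R, measurable B ->
    P ((fun w => W t w - W s w) @^-1` B) = normal_prob 0 (Num.sqrt (t - s)) B ;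
  bm_independent : forall s t : R, 0 <= s -> s < t -> t <= S ->
    forall (E : set Omega) (B : set R),
    natural_filtration W s E -> measurable B ->
    P (E `&` (fun w => W t w - W s w) @^-1` B) =
    (P E * P ((fun w => W t w - W s w)%R @^-1` B))%E }.

(* The simple process \sum_(k < size) coef k * \1_`]time k, time k.+1]. *)
Record simple_process := SimpleProcess {
  sp_size : nat ;
  sp_time : nat -> R ;
  sp_coef : nat -> Omega -> R }.

Definition sp_valid F (t : R) (H : simple_process) :=
  [/\ forall k, (k <= sp_size H)%N -> 0 <= sp_time H k <= t,
      forall k, (k < sp_size H)%N -> sp_time H k <= sp_time H k.+1,
      forall k, (k < sp_size H)%N ->
        sub_measurable (F (sp_time H k)) (sp_coef H k)
    & forall k, (k < sp_size H)%N -> exists M, forall w, `|sp_coef H k w| <= M].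

Definition sp_eval (H : simple_process) (u : R) (w : Omega) : R :=
  \sum_(k < sp_size H)
    sp_coef H k w * (sp_time H k < u <= sp_time H k.+1)%R%:R.

Definition sp_integral W (H : simple_process) (w : Omega) : R :=
  \sum_(k < sp_size H)
    sp_coef H k w * (W (sp_time H k.+1) w - W (sp_time H k) w).

(* I is (a version of) the Ito integral of H against W over [0, t]: an L^2 limit
   of the integrals of simple processes approximating H in L^2(P (x) du). *)
Definition is_ito_integral F W (H : R -> Omega -> R) (t : R)
    (I : {RV P >-> R}) :=
  exists Hn : nat -> simple_process,
    [/\ forall n, sp_valid F t (Hn n),
        (fun n => \int[P]_w \int[lebesgue_measure]_(u in `[0%R, t])
            ((sp_eval (Hn n) u w - H u w) ^+ 2)%:E)%E @ \oo --> 0%E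
      & (fun n => \int[P]_w ((sp_integral W (Hn n) w - I w) ^+ 2)%:E)%E @ \oo
            --> 0%E].

Record strong_solution (b sigma : R -> R) (x0 S : R) W X : Prop :=
  StrongSolution {
  sol_continuous : continuous_paths S X ;
  sol_adapted : adapted S (augmented_filtration W) X ;
  sol_start : {ae P, forall w, X 0 w = x0} ;
  sol_equation : forall t, 0 <= t <= S -> exists I : {RV P >-> R},
    is_ito_integral (augmented_filtration W) W (fun u w => sigma (X u w)) t I /\
    {ae P, forall w,
      X t w = x0 + \int[lebesgue_measure]_(u in `[0, t]) b (X u w) + I w} }.

(* X is on [0, S] a homogeneous Markov process (for its natural filtration) with
   transition density (t, x, y) |-> p t x y. *)
Record markov_transition_density (S : R) X (p : R -> R -> R -> R) : Prop :=
  MarkovTransitionDensity {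
  td_measurable : measurable_fun
    [set z : R * R * R | 0 < z.1.1 <= S] (fun z => p z.1.1 z.1.2 z.2) ;
  td_ge0 : forall t x y, 0 < t <= S -> 0 <= p t x y ;
  td_int1 : forall t x, 0 < t <= S ->
    (\int[lebesgue_measure]_y (p t x y)%:E = 1)%E ;
  td_markov : forall s t : R, 0 <= s -> 0 < t -> s + t <= S ->
    forall (E : set Omega) (B : set R),
    natural_filtration X s E -> measurable B ->
    (P (E `&` X (s + t)%R @^-1` B)
     = \int[P]_(w in E) \int[lebesgue_measure]_(y in B) (p t (X s w) y)%:E)%E }.

Record independent_copies (b sigma : R -> R) (x0 S : R) X (N : nat)
    (Wi Xi : 'I_N -> R -> {RV P >-> R}) : Prop := IndependentCopies {
  ic_brownian : forall i, brownian_motion S (Wi i) ;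
  ic_solution : forall i, strong_solution b sigma x0 S (Wi i) (Xi i) ;
  ic_driving_independent : independent (fun i => natural_filtration (Wi i) S) ;
  ic_independent : independent (fun i => natural_filtration (Xi i) S) ;
  ic_same_law : forall i, same_law S (Xi i) X }.

End processes.

Section estimators.
Context {R : realType}.
Local Notation mu := (@lebesgue_measure R).
Local Notation mu2 := (@lebesgue_measure R \x @lebesgue_measure R)%E.
Implicit Types (f g K : R -> R) (p : R -> R -> R -> R).

Definition C1_bounded_derivative g :=
  [/\ forall x, derivable g x 1, continuous (g^`())%classic
    & exists M, forall x, `|(g^`())%classic x| <= M].

Definition averaged_density p (x0 T t0 : R) (x : R) : R :=
  (T - t0)^-1 * \int[mu]_(s in `[t0, T]) p s x0 x.

Definition joint_density f p (t x y : R) : R := f x * p t x y.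

(* Bounds p t for every t >= t0, and blows up as t0 -> 0.  At a time t that may be
   smaller than t0 the applicable bound is m_p cbar (Num.min t0 t). *)
Definition m_p (cbar t0 : R) : R := cbar / Num.sqrt t0.

Definition m_f (c T t0 : R) : R := 2 * c / Num.sqrt (T - t0).

(* The constants cbar and c depend on T but not on the initial time t0. *)
Record density_bounds p (x0 T cbar c : R) : Prop := DensityBounds {
  db_cbar_gt0 : 0 < cbar ;
  db_c_gt0 : 0 < c ;
  db_p : forall t0, 0 < t0 < T ->
    forall t x y, t0 <= t <= T -> p t x y <= m_p cbar t0 ;
  db_f : forall t0, 0 <= t0 < T ->
    forall x, `|averaged_density p x0 T t0 x| <= m_f c T t0 }.

Definition kernel_function K :=
  mu.-integrable setT (EFin \o K) /\ \int[mu]_x K x = 1.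

Definition Kh K (h x : R) : R := h^-1 * K (x / h).

Definition Qh K (h1 h2 x y : R) : R := Kh K h1 x * Kh K h2 y.

Definition convolution f g (x : R) : R := \int[mu]_u (f (x - u) * g u).

Definition convolution2 (f g : R -> R -> R) (x y : R) : R :=
  \int[mu2]_z (f (x - z.1) (y - z.2) * g z.1 z.2).

Definition norm_R g : \bar R := ('N[mu]_2[EFin \o g])%E.

Definition norm_R2 (g : R -> R -> R) : \bar R :=
  ('N[mu2]_2[EFin \o (fun z => g z.1 z.2)])%E.

Definition sqnorm_weighted f (g : R -> R -> R) : \bar R :=
  (\int[mu2]_z (g z.1 z.2 ^+ 2 * f z.2)%R%:E)%E.

Definition sqnorm_strip (l r : R) (g : R -> R -> R) : \bar R :=
  (\int[mu2]_(z in `[l, r] `*` setT) (g z.1 z.2 ^+ 2)%R%:E)%E.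

Definition sqnorm_weighted_strip f (l r : R) (g : R -> R -> R) : \bar R :=
  (\int[mu2]_(z in `[l, r] `*` setT) (g z.1 z.2 ^+ 2 * f z.2)%R%:E)%E.

Variables (d : measure_display) (Omega : measurableType d).
Variables (P : probability Omega R) (N : nat).
Variable Xi : 'I_N -> R -> {RV P >-> R}.

Definition s_hat K (T t0 h1 h2 t : R) (w : Omega) (x y : R) : R :=
  (N%:R * (T - t0))^-1 *
  \sum_(i < N) \int[mu]_(s in `[t0, T])
    Qh K h1 h2 (Xi i s w - x) (Xi i (s + t) w - y).

Definition f_hat K (T t0 ell : R) (w : Omega) (x : R) : R :=
  (N%:R * (T - t0))^-1 *
  \sum_(i < N) \int[mu]_(s in `[t0, T]) Kh K ell (Xi i s w - x).

Definition p_hat K (m T t0 h1 h2 ell t : R) (w : Omega) (x y : R) : R :=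
  s_hat K T t0 h1 h2 t w x y / f_hat K T t0 ell w x
  * (m / 2 < f_hat K T t0 ell w x)%R%:R.

End estimators.

(* Main.v *)
(* Since f > m on [l, r], thresholding f_hat at m / 2 costs at most a multiple of
   |f_hat - f|, so that |p_hat - p_t| <= (2 / m) (|s_hat - s_t| + p_t |f_hat - f|).
   Squaring and using p_t <= m_p and \int p_t(x, y) dy = 1 reduces both bounds to
   the L^2 risks of s_hat and f_hat.  The means of s_hat and f_hat are s_h and f_l
   because (X_s, X_(s+t)) has density p_s(x0, u) p_t(u, v); the variances are
   bounded by the squared norms of the kernels divided by N because the N copies
   are independent (Cauchy-Schwarz in time, then Tonelli).  No cross term between
   bias and variance is needed, thanks to the constant 16.

   The estimators are only measurable up to the null set where some path is not
   continuous; off that set they coincide with jointly measurable versions. *)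
Require Import Defs.
From HB Require Import structures.
From mathcomp Require Import all_boot all_order all_algebra.
From mathcomp Require Import all_classical all_reals all_analysis.
From mathcomp Require Import measurable_realfun ring lra.
Import Order.TTheory GRing.Theory Num.Theory.
Import numFieldNormedType.Exports.
Local Open Scope classical_set_scope.
Local Open Scope ring_scope.

Set Implicit Arguments.
Unset Strict Implicit.
Unset Printing Implicit Defensive.

(** * Integration *)

(** Both inequalities are instances of one weighted estimate: a weight [g] of the second variable,
    with [0 <= g <= G], is carried through the whole argument, and the two cases are [g = 1],
    [G = 1] and [g = f], [G = m_f]. The weight is replaced by [G] everywhere except in the bias of
    [s_h], where it is kept; this is why only that term is measured in the weighted norm. The
    obstacle that shapes the proof is that a real-valued integral is [fine] of an extended one,
    hence 0 when the latter is infinite. Moments are therefore computed on nonnegative extended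
    functions, by Tonelli alone, and [fine] is removed only where finiteness has been established,
    often almost surely. The symmetry of [K] turns the kernel at [X - x] of the estimators into the
    kernel at [x - u] of the convolutions. The horizon [2 * T] leaves room for [s + t] when both [s]
    and [t] are at most [T]. *)

Section product_sigma_finite.
Context d1 d2 (T1 : measurableType d1) (T2 : measurableType d2) (R : realType).
Variable m1 : {sigma_finite_measure set T1 -> \bar R}.
Variable m2 : {sigma_finite_measure set T2 -> \bar R}.

(** Rectangles with the same index on both sides suffice: the two exhaustions are nondecreasing, so
    a point reached at indices [n] and [k] is reached at [maxn n k]. *)
Lemma product_sigma_finite : sigma_finite setT (m1 \x m2)%E.
Proof.
have /sigma_finiteP[F [TF ndF Foo]] := sigma_finiteT m1.
have /sigma_finiteP[G [TG ndG Goo]] := sigma_finiteT m2.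
exists (fun n => F n `*` G n).
  rewrite -setXTT TF TG; apply/seteqP; split => -[x y] /=.
    move=> [[n _ Fnx] [k _ Gky]]; exists (maxn n k) => //; split.
    - by move: x Fnx; exact/subsetPset/ndF/leq_maxl.
    - by move: y Gky; exact/subsetPset/ndG/leq_maxr.
  by move=> [n _ []/= ? ?]; split; exists n.
move=> k; have [? ?] := Foo k; have [? ?] := Goo k.
split; first exact: measurableX.
by rewrite product_measure1E// lte_mul_pinfty// ge0_fin_numE.
Qed.

(* The canonical sigma-finite structure on a product measure is the one that the
   library derives for finite factors, which does not apply to Lebesgue measure. *)
Definition sigma_finite_product : {sigma_finite_measure set (T1 * T2)%type -> \bar R} :=
  HB.pack (m1 \x m2)%E
    (Measure_isSigmaFinite.Build _ _ _ (m1 \x m2)%E product_sigma_finite).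

End product_sigma_finite.

(* [lebesgue_measure] lives on [measurableTypeR R], which is convertible to [R] but
   does not unify with it as a measurable type: whence [Rm] below. *)
Definition lebesgue2 (R : realType) :=
  sigma_finite_product (@lebesgue_measure R) (@lebesgue_measure R).

Section lower.
Context d (T : measurableType d) (R : realType) (mu : {measure set T -> \bar R}).
Local Open Scope ereal_scope.
Import HBNNSimple.

(* The integral of a nonnegative function is defined as a lower integral, hence is
   monotone on all functions. *)
Lemma le_lower_integral (D : set T) (f g : T -> \bar R) :
  (forall x, D x -> 0 <= f x <= g x) ->
  \int[mu]_(x in D) f x <= \int[mu]_(x in D) g x.
Proof.
move=> fg.
have pos (h : T -> \bar R) : (forall x, D x -> 0 <= h x) ->
    ((h \_ D)^\+ = h \_ D) /\ ((h \_ D)^\- = cst 0).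
  move=> h0; have h0' x : 0 <= (h \_ D) x.
    by rewrite patchE; case: ifPn => // /[!inE] /h0.
  split; apply/funext => x; first by rewrite funeposE; apply/max_idPl.
  by rewrite funenegE; apply/max_idPr; rewrite leeNl oppe0.
rewrite /integral.
have [-> ->] := pos f (fun x Dx => proj1 (andP (fg x Dx))).
have [-> ->] := pos g (fun x Dx => le_trans (proj1 (andP (fg x Dx))) (proj2 (andP (fg x Dx)))).
apply: leeB => //; apply: ereal_sup_le => _ [h /= hf <-]; exists h => //= x.
apply: le_trans (hf x) _; rewrite !patchE; case: ifPn => // /[!inE] /fg /andP[] //.
Qed.

(** Raising [g] to [+oo] on the null set [N] does not change its integral and makes it dominate [f]
    everywhere. Measurability is asked of [g] alone, which allows [f] to be a loss built from
    arbitrary paths. *)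
Lemma ae_le_lower_integral (N : set T) (f g : T -> \bar R) :
  measurable N -> mu N = 0 -> measurable_fun setT g ->
  (forall x, 0 <= f x) -> (forall x, 0 <= g x) ->
  (forall x, ~ N x -> f x <= g x) ->
  \int[mu]_x f x <= \int[mu]_x g x.
Proof.
move=> mN N0 mg f0 g0 fg.
pose k := fun x => if x \in N then +oo else g x.
have mk : measurable_fun setT k.
  apply: measurable_fun_ifT => //=.
  by apply: (measurable_fun_bool true); rewrite setTI preimage_mem_true.
rewrite (@ge0_ae_eq_integral _ _ _ mu setT g k)//; last 2 first.
- by move=> x _; rewrite /k; case: ifPn.
- exists N; split => // x /=; apply: contra_notP => Nx _.
  by rewrite /k memNset.
apply: le_lower_integral => x _; rewrite f0 /k/=; case: ifPn => //; first by rewrite leey.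
by rewrite notin_setE => /fg.
Qed.

End lower.

Section density.
Context d (T : measurableType d) (R : realType).
Variables (mu nu : {measure set T -> \bar R}) (rho : T -> R).
Local Open Scope ereal_scope.
Import HBNNSimple.
Hypothesis mrho : measurable_fun setT rho.
Hypothesis rho0 : forall x, (0 <= rho x)%R.
Let mErho : measurable_fun setT (EFin \o rho).
Proof. exact/measurable_EFinP. Qed.
Hypothesis nuE : forall A, measurable A -> nu A = \int[mu]_(x in A) (rho x)%:E.

(** On simple functions this is [nuE] applied to the level sets; monotone convergence on both sides
    gives the general case. *)
Lemma ge0_integral_density (g : T -> \bar R) :
  measurable_fun setT g -> (forall x, 0 <= g x) ->
  \int[nu]_x g x = \int[mu]_x (g x * (rho x)%:E).
Proof.
move=> mg g0.
pose h := nnsfun_approx measurableT mg.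
have hg x : (EFin \o h^~ x) n @[n --> \oo] --> g x.
  by apply: cvg_nnsfun_approx.
have ndh x a b : (a <= b)%N -> (h a x <= h b x)%R.
  by move=> ab; exact/lefP/nd_nnsfun_approx.
have step n : \int[nu]_x (h n x)%:E = \int[mu]_x ((h n x)%:E * (rho x)%:E).
  under eq_integral do rewrite fimfunE -fsumEFin//.
  rewrite ge0_integral_fsum//; last 2 first.
  - by move=> r; exact/measurable_EFinP/measurable_funM.
  - by move=> r x _; rewrite nnfun_muleindic_ge0.
  under [RHS]eq_integral => x _.
    rewrite fimfunE -fsumEFin// ge0_mule_fsuml; last first.
      by move=> r; exact: nnfun_muleindic_ge0.
    over.
  rewrite [RHS]ge0_integral_fsum//; last 2 first.
  - move=> r; apply: emeasurable_funM => //.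
    exact/measurable_EFinP/measurable_funM.
  - move=> r x _; apply: mule_ge0; last by rewrite lee_fin.
    by rewrite ?EFinM; exact: nnfun_muleindic_ge0.
  apply: eq_fsbigr => r rh.
  rewrite integralZl_indic_nnsfun// integral_indic// setIT.
  under [RHS]eq_integral do rewrite EFinM -muleA.
  rewrite ge0_integralZl//; last 3 first.
  - apply: emeasurable_funM => //; exact/measurable_EFinP.
  - by move=> x _; rewrite mule_ge0// lee_fin.
  - by move: rh; rewrite inE => -[t _ <-]; rewrite lee_fin.
  congr (_ * _); rewrite nuE// [LHS]integral_mkcond.
  by apply: eq_integral => x _; rewrite epatch_indic/= muleC.
transitivity (limn (fun n => \int[nu]_x (h n x)%:E)).
  rewrite -monotone_convergence//.
  - by apply: eq_integral => x _; apply/esym/cvg_lim => //; exact: hg.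
  - by move=> n; exact/measurable_EFinP.
  - by move=> n x _; rewrite lee_fin.
  - by move=> x _ a b ab; rewrite lee_fin ndh.
under eq_fun do rewrite step.
rewrite -monotone_convergence//.
- apply: eq_integral => x _; apply/cvg_lim => //.
  by apply: cvgeZr => //; exact: hg.
- by move=> n; apply: emeasurable_funM => //; exact/measurable_EFinP.
- by move=> n x _; rewrite mule_ge0// lee_fin.
- by move=> x _ a b ab; apply: lee_wpmul2r; rewrite lee_fin//; exact: ndh.
Qed.

End density.

Section restriction.
Context d (T : measurableType d) (R : realType) (mu : {measure set T -> \bar R}).
Variables (D : set T) (mD : measurable D).
Local Open Scope ereal_scope.

(** The restricted measure has density [\1_D] with respect to [mu]. *)
Lemma ge0_integral_mrestr (f : T -> \bar R) : measurable_fun setT f ->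
  (forall x, 0 <= f x) ->
  \int[mrestr mu mD]_x f x = \int[mu]_(x in D) f x.
Proof.
move=> mf f0.
rewrite (@ge0_integral_density _ _ _ mu _ \1_D)//.
- by rewrite [RHS]integral_mkcond; under [RHS]eq_integral do rewrite epatch_indic.
- by move=> A mA; rewrite integral_indic// setIC.
Qed.

Lemma integral_mrestr (f : T -> \bar R) : measurable_fun setT f ->
  \int[mrestr mu mD]_x f x = \int[mu]_(x in D) f x.
Proof.
move=> mf; rewrite [LHS]integralE [RHS]integralE !ge0_integral_mrestr//.
- exact: measurable_funeneg.
- exact: measurable_funepos.
Qed.

End restriction.

(** * Lebesgue measure under the reflected dilation [x |-> (a - x) / h] *)

Section affine.
Context (R : realType).
Local Notation mu := (@lebesgue_measure R).
Variables (a h : R).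
Hypothesis h0 : 0 < h.
Let phi (x : R) : R := (a - x) / h.
Let mphi : measurable_fun setT (phi : R -> measurableTypeR R).
Proof. by apply: measurable_funM => //; apply: measurable_funB. Qed.

Let hV0 : 0 <= h^-1. Proof. by rewrite invr_ge0 ltW. Qed.

Let nu : {measure set (measurableTypeR R) -> \bar R}.
Proof. by refine (mscale (NngNum hV0) (pushforward mu (phi : R -> measurableTypeR R))). Defined.

(** It is enough to compare half-open intervals. The map reverses the order, so the preimage of ]u,
    v] is closed on the left and open on the right; its length [h * (v - u)] is compensated by the
    factor [h^-1] in [nu]. *)
Lemma lebesgue_measure_affine (A : set R) : measurable A ->
  mu A = nu A.
Proof.
move=> mA.
apply: lebesgue_measure_unique => //= _ [[u v]] /= uv <-.
rewrite /nu /= /mscale /= /pushforward.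
have -> : phi @^-1` `]u, v] = `[a - h * v, a - h * u[%classic.
  apply/seteqP; split => x /=; rewrite !in_itv/= /phi.
    by rewrite ltr_pdivlMr// ler_pdivrMr// => /andP[? ?]; apply/andP; split; lra.
  by rewrite ltr_pdivlMr// ler_pdivrMr// => /andP[? ?]; apply/andP; split; lra.
rewrite !lebesgue_measure_itv/= !lte_fin.
have -> : (a - h * v < a - h * u) = (u < v) by rewrite ltrD2l ltrN2 ltr_pM2l.
case: ifPn => _; last by rewrite mule0.
rewrite -!EFinD -EFinM; congr EFin; field; exact: lt0r_neq0.
Qed.

Lemma ge0_integral_affine (g : R -> \bar R) : measurable_fun setT g ->
  (forall x, (0 <= g x)%E) ->
  (\int[mu]_x g ((a - x) / h)%R = h%:E * \int[mu]_x g x)%E.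
Proof.
move=> mg g0.
have -> : (\int[mu]_x g x = \int[nu]_x g x)%E.
  by apply: eq_measure_integral => A mA _; exact: lebesgue_measure_affine.
rewrite /nu ge0_integral_mscale//= ge0_integral_pushforward//=.
rewrite preimage_setT muleA -EFinM divff ?mul1e//; exact: lt0r_neq0.
Qed.

End affine.

Section cauchy_schwarz.
Context d (T : measurableType d) (R : realType) (mu : {measure set T -> \bar R}).
Local Open Scope ereal_scope.

(** Integrating [q x * q y <= q x ^+ 2 / 2 + q y ^+ 2 / 2] in [y] and then in [x] gives the
    Cauchy-Schwarz bound against the constant 1, infinite values included. *)
Lemma sqr_integral_le (q : T -> R) : measurable_fun setT q ->
  (forall x, (0 <= q x)%R) ->
  (\int[mu]_x (q x)%:E) * (\int[mu]_x (q x)%:E) <=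
  mu setT * \int[mu]_x ((q x) ^+ 2)%:E.
Proof.
move=> mq q0; set c := \int[mu]_x (q x)%:E; set B := \int[mu]_x ((q x) ^+ 2)%:E.
have mEq : measurable_fun setT (EFin \o q) by exact/measurable_EFinP.
have mq2 : measurable_fun setT (fun x => ((q x) ^+ 2)%:E).
  by apply/measurable_EFinP; exact: measurable_funX.
have c0 : 0 <= c by apply: integral_ge0 => x _; rewrite lee_fin.
have B0 : 0 <= B by apply: integral_ge0 => x _; rewrite lee_fin sqr_ge0.
rewrite {1}/c -ge0_integralZr//; last by move=> x _; rewrite lee_fin.
have mh : measurable_fun setT (fun x => (q x ^+ 2 / 2)%:E).
  by apply/measurable_EFinP; apply: measurable_funM => //; exact: measurable_funX.
have h0 x : 0 <= (q x ^+ 2 / 2)%:E by rewrite lee_fin divr_ge0// sqr_ge0.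
have Bh : \int[mu]_x (q x ^+ 2 / 2)%:E = (2^-1)%:E * B.
  rewrite /B -ge0_integralZl//; last by move=> x _; rewrite lee_fin sqr_ge0.
  by under [RHS]eq_integral do rewrite -EFinM mulrC.
apply: (@le_trans _ _ (\int[mu]_x ((q x ^+ 2 / 2)%:E * mu setT + (2^-1)%:E * B))).
  apply: ge0_le_integral => //.
  - by move=> x _; rewrite mule_ge0// lee_fin.
  - by apply: emeasurable_funM.
  - by apply: emeasurable_funD => //; apply: emeasurable_funM.
  move=> x _.
  have -> : (q x ^+ 2 / 2)%:E * mu setT = \int[mu]_y (cst (q x ^+ 2 / 2)%:E y).
    by rewrite integral_cst.
  rewrite -Bh /c -ge0_integralZl//; last 2 first.
  - by move=> y _; rewrite lee_fin.
  - by rewrite lee_fin.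
  rewrite -ge0_integralD//; last by move=> y _; exact: h0.
  apply: ge0_le_integral => //.
  - by move=> y _; rewrite mule_ge0// lee_fin.
  - by apply: emeasurable_funM.
  - by apply: emeasurable_funD.
  move=> y _ /=; rewrite -EFinM -EFinD lee_fin.
  by have := sqr_ge0 (q x - q y)%R; rewrite !expr2; lra.
rewrite ge0_integralD//; last 3 first.
- by move=> x _; rewrite mule_ge0.
- by apply: emeasurable_funM.
- by move=> x _; rewrite mule_ge0.
rewrite ge0_integralZr// integral_cst// Bh.
rewrite [X in X + _]muleC [X in _ + X]muleC.
rewrite -ge0_muleDr ?mule_ge0//; apply: lee_wpmul2l => //.
rewrite -ge0_muleDl// -EFinD.
have -> : (2^-1 + 2^-1 = 1 :> R)%R by field.
by rewrite mul1e.
Qed.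

End cauchy_schwarz.

(** * Variance of occupation integrals *)

Section product_of_integrals.
Context d d' (Om : measurableType d) (S : measurableType d') (R : realType).
Variables (P : {sigma_finite_measure set Om -> \bar R}).
Variables (lam : {sigma_finite_measure set S -> \bar R}).
Local Open Scope ereal_scope.
Variables G H : S * Om -> \bar R.
Hypothesis mG : measurable_fun setT G.
Hypothesis mH : measurable_fun setT H.
Hypothesis G0 : forall z, 0 <= G z.
Hypothesis H0 : forall z, 0 <= H z.
Hypothesis GH : forall s s', \int[P]_w (G (s, w) * H (s', w)) =
  \int[P]_w G (s, w) * \int[P]_w H (s', w).

(** The factorization [GH] is known for each pair of times. A first use of Tonelli takes the time
    integral of [G] outside, with the whole integral [K] of [H] as a factor; a second one, at fixed
    [s], does the same for [H]. *)
Lemma integral_mul_integrals :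
  \int[P]_w (\int[lam]_s G (s, w) * \int[lam]_s H (s, w)) =
  (\int[P]_w \int[lam]_s G (s, w)) * (\int[P]_w \int[lam]_s H (s, w)).
Proof.
pose K w := \int[lam]_s H (s, w).
have K0 w : 0 <= K w by apply: integral_ge0 => s _.
have mK : measurable_fun setT K by exact: (measurable_fun_fubini_tonelli_G H).
have mG1 w : measurable_fun setT (fun s => G (s, w)).
  exact: measurableT_comp mG (pair2_measurable w).
have mG2 s : measurable_fun setT (fun w => G (s, w)).
  exact: measurableT_comp mG (pair1_measurable s).
have mH1 w : measurable_fun setT (fun s => H (s, w)).
  exact: measurableT_comp mH (pair2_measurable w).
have mH2 s : measurable_fun setT (fun w => H (s, w)).
  exact: measurableT_comp mH (pair1_measurable s).
have mGK : measurable_fun setT (fun z : S * Om => G z * K z.2).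
  by apply: emeasurable_funM => //; exact: measurableT_comp mK measurable_snd.
transitivity (\int[P]_w \int[lam]_s (G (s, w) * K w)).
  by apply: eq_integral => w _; rewrite ge0_integralZr.
rewrite -(fubini_tonelli (fun z => G z * K z.2))//; last first.
  by move=> z; rewrite mule_ge0.
rewrite -(fubini_tonelli G)// -(fubini_tonelli H)//.
rewrite -ge0_integralZr//; last 3 first.
- exact: (measurable_fun_fubini_tonelli_F G).
- by move=> s _; exact: integral_ge0.
- by apply: integral_ge0 => s _; exact: integral_ge0.
apply: eq_integral => s _ /=.
rewrite -ge0_integralZl//; last 3 first.
- exact: (measurable_fun_fubini_tonelli_F H).
- by move=> s' _; exact: integral_ge0.
- exact: integral_ge0.
under [RHS]eq_integral do rewrite -GH.
have mGH : measurable_fun setT (fun z : S * Om => G (s, z.2) * H z).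
  apply: emeasurable_funM => //; exact: measurableT_comp (mG2 s) measurable_snd.
rewrite (fubini_tonelli (fun z => G (s, z.2) * H z))//; last first.
  by move=> z; rewrite mule_ge0.
by apply: eq_integral => w _; rewrite /= ge0_integralZl.
Qed.

End product_of_integrals.

Section uncorrelated.
Context d (T : measurableType d) (R : realType) (P : probability T R).
Implicit Types f g : T -> R.

Lemma integrable_sqr_integrableM f g :
  measurable_fun setT f -> measurable_fun setT g ->
  P.-integrable setT (EFin \o (fun w => f w ^+ 2)) ->
  P.-integrable setT (EFin \o (fun w => g w ^+ 2)) ->
  P.-integrable setT (EFin \o (fun w => f w * g w)).
Proof.
move=> mf mg f2 g2.
apply: (@le_integrable _ _ _ _ setT measurableT _ (EFin \o (fun w => f w ^+ 2 + g w ^+ 2))).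
- by apply/measurable_EFinP; exact: measurable_funM.
- move=> w _ /=; rewrite lee_fin normrM [leRHS]ger0_norm ?addr_ge0 ?sqr_ge0//.
  rewrite -(real_normK (num_real (f w))) -(real_normK (num_real (g w))).
  have := sqr_ge0 (`|f w| - `|g w|); have := mulr_ge0 (normr_ge0 (f w)) (normr_ge0 (g w)).
  by rewrite !expr2; lra.
- exact: eq_integrable (integrableD measurableT f2 g2).
Qed.

Lemma integrableD_EFin f g : P.-integrable setT (EFin \o f) ->
  P.-integrable setT (EFin \o g) ->
  P.-integrable setT (EFin \o (fun w => f w + g w)).
Proof.
by move=> fi gi; apply: eq_integrable (integrableD measurableT fi gi).
Qed.

Lemma integrableB_EFin f g : P.-integrable setT (EFin \o f) ->
  P.-integrable setT (EFin \o g) ->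
  P.-integrable setT (EFin \o (fun w => f w - g w)).
Proof.
by move=> fi gi; apply: eq_integrable (integrableB measurableT fi gi).
Qed.

Lemma integrable_cst_prob (r : R) : P.-integrable setT (EFin \o cst r).
Proof. exact: finite_measure_integrable_cst. Qed.

Lemma integrable_sqr_integrable f : measurable_fun setT f ->
  P.-integrable setT (EFin \o (fun w => f w ^+ 2)) ->
  P.-integrable setT (EFin \o f).
Proof.
move=> mf f2.
have -> : f = (fun w => f w * (cst 1 : T -> R) w).
  by apply/funext => w; rewrite mulr1.
apply: integrable_sqr_integrableM => //=.
by under [X in _ \o X]eq_fun do rewrite expr1n; exact: integrable_cst_prob.
Qed.

Variables (N : nat) (y : 'I_N -> T -> R) (e : R).
Hypothesis my : forall i, measurable_fun setT (y i).
Hypothesis y2 : forall i, P.-integrable setT (EFin \o (fun w => y i w ^+ 2)).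
Hypothesis Ey : forall i, \int[P]_w y i w = e.
Hypothesis Eyy : forall i j, i != j -> \int[P]_w (y i w * y j w) = e ^+ 2.

Let yi i : P.-integrable setT (EFin \o y i).
Proof. exact: integrable_sqr_integrable. Qed.

Let yyi i j : P.-integrable setT (EFin \o (fun w => y i w * y j w)).
Proof. exact: integrable_sqr_integrableM. Qed.

Let c i w := y i w - e.

Let ccE i j : (fun w => c i w * c j w) =
  (fun w => (y i w * y j w + (- e) * (y i w + y j w)) + cst (e ^+ 2) w).
Proof. by apply/funext => w; rewrite /c /=; ring. Qed.

Let Dyi i j : P.-integrable setT (EFin \o (fun w => - e * (y i w + y j w))).
Proof.
have := integrableZl measurableT (- e) (integrableD measurableT (yi i) (yi j)).
by apply: eq_integrable => // w _ /=.
Qed.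

Let ci i j : P.-integrable setT (EFin \o (fun w => c i w * c j w)).
Proof.
rewrite ccE; apply: integrableD_EFin (integrable_cst_prob _).
exact: integrableD_EFin (yyi i j) (Dyi i j).
Qed.

Let Ecc i j : \int[P]_w (c i w * c j w) = \int[P]_w (y i w * y j w) - e ^+ 2.
Proof.
under eq_Rintegral do rewrite [c i _ * c j _](congr1 (fun h => h _) (ccE i j)).
rewrite RintegralD//; last 2 first.
- exact: integrableD_EFin.
- exact: integrable_cst_prob.
rewrite RintegralD// RintegralZl//; last exact: integrableD_EFin.
rewrite RintegralD// !Ey Rintegral_cst//= probability_setT/=; ring.
Qed.

(** In the expanded square of the centred sum, the off-diagonal terms integrate to 0 by [Eyy], and
    each diagonal term is a variance, at most the second moment. *)
Lemma uncorrelated_variance_le :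
  (\int[P]_w ((\sum_i y i w - N%:R * e) ^+ 2)%:E <=
   \sum_i \int[P]_w (y i w ^+ 2)%:E)%E.
Proof.
have sqrE w : ((\sum_i y i w - N%:R * e) ^+ 2)%:E =
    (\sum_i \sum_j (c i w * c j w)%:E)%E.
  under [RHS]eq_bigr do rewrite sumEFin -mulr_sumr.
  rewrite [RHS]sumEFin -mulr_suml -expr2 /c big_split/= sumr_const card_ord.
  by rewrite mulNrn mulr_natl.
under eq_integral do rewrite sqrE.
rewrite integral_sum//; last first.
  move=> i; apply: integrable_sum => // j _; exact: ci.
apply: lee_sum => i _.
rewrite integral_sum//; last by move=> j; exact: ci.
rewrite (bigD1 i)//= [X in (_ + X)%E]big1 ?adde0.
  rewrite -[X in (X <= _)%E]fineK; last exact: (integrable_fin_num measurableT (ci i i)).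
  rewrite -[X in (_ <= X)%E]fineK; last exact: (integrable_fin_num measurableT (y2 i)).
  rewrite lee_fin -/(Rintegral _ _ _) Ecc.
  by under eq_Rintegral do rewrite -expr2; rewrite lerBlDr lerDl sqr_ge0.
move=> j ji; rewrite -[LHS]fineK; last exact: (integrable_fin_num measurableT (ci i j)).
by rewrite -/(Rintegral _ _ _) Ecc Eyy ?subrr// eq_sym.
Qed.

End uncorrelated.

(** * Time integrals of a fixed kernel along pairwise independent copies *)

Section occupation.
Context dO dS dE (Om : measurableType dO) (S : measurableType dS)
  (E : measurableType dE) (R : realType).
Variables (P : probability Om R) (lam : {finite_measure set S -> \bar R}) (L : R).
Hypothesis L0 : 0 < L.
Hypothesis lamT : lam setT = L%:E.
Variables (nu : {measure set E -> \bar R}) (rho : E -> R).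
Hypothesis mrho : measurable_fun setT rho.
Hypothesis rho0 : forall z, 0 <= rho z.
Variables (N : nat) (U : 'I_N -> S * Om -> E).
Hypothesis N0 : (0 < N)%N.
Hypothesis mU : forall i, measurable_fun setT (U i).
Local Open Scope ereal_scope.
Hypothesis occ : forall i (g : E -> \bar R), measurable_fun setT g ->
  (forall z, 0 <= g z) ->
  \int[P]_w \int[lam]_s g (U i (s, w)) =
  L%:E * \int[nu]_z (g z * (rho z)%:E).
Hypothesis ind : forall i j, i != j -> forall g h : E -> \bar R,
  measurable_fun setT g -> measurable_fun setT h ->
  (forall z, 0 <= g z) -> (forall z, 0 <= h z) -> forall s s',
  \int[P]_w (g (U i (s, w)) * h (U j (s', w))) =
  \int[P]_w g (U i (s, w)) * \int[P]_w h (U j (s', w)).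

Let time_int (g : E -> \bar R) i w := \int[lam]_s g (U i (s, w)).
Let mean (g : E -> \bar R) := L%:E * \int[nu]_z (g z * (rho z)%:E).

Let mgU i (g : E -> \bar R) : measurable_fun setT g ->
  measurable_fun setT (fun z => g (U i z)).
Proof. by move=> mg; exact: measurableT_comp mg (mU i). Qed.

Let mgUs i w (g : E -> \bar R) : measurable_fun setT g ->
  measurable_fun setT (fun s => g (U i (s, w))).
Proof.
by move=> mg; exact: measurableT_comp (mgU i mg) (pair2_measurable w).
Qed.

Let m_time_int i (g : E -> \bar R) : measurable_fun setT g ->
  (forall z, 0 <= g z) -> measurable_fun setT (time_int g i).
Proof.
move=> mg g0.
exact: (@measurable_fun_fubini_tonelli_G _ _ _ _ _ lam (fun z => g (U i z)) (mgU i mg)).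
Qed.

(* The positive and negative parts of the kernel are treated separately, so that
   Tonelli's theorem suffices for all the moment computations. *)
Section fixed_kernel.
Variable q : E -> R.
Hypothesis mq : measurable_fun setT q.

Let absq z := `|q z|%:E.
Let mabsq : measurable_fun setT absq.
Proof. by apply/measurable_EFinP; exact: measurableT_comp. Qed.
Let absq0 z : 0 <= absq z. Proof. by rewrite lee_fin. Qed.

Let A i w := time_int absq i w.
Let A0 i w : 0 <= A i w. Proof. exact: integral_ge0. Qed.
Let mA i : measurable_fun setT (A i).
Proof. exact: m_time_int. Qed.

Let B := \int[nu]_z ((q z ^+ 2)%:E * (rho z)%:E).
Hypothesis Boo : B < +oo.

Let mq2 : measurable_fun setT (fun z => (q z ^+ 2)%:E).
Proof. by apply/measurable_EFinP; exact: measurable_funX. Qed.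

Let sq0 z : 0 <= (q z ^+ 2)%:E. Proof. by rewrite lee_fin sqr_ge0. Qed.

Let AA i : \int[P]_w (A i w * A i w) <= L%:E * (L%:E * B).
Proof.
rewrite -(occ i)//.
rewrite -ge0_integralZl//; last 3 first.
- exact: (m_time_int i mq2 sq0).
- by move=> w _; exact: integral_ge0.
- by rewrite lee_fin ltW.
apply: ge0_le_integral => //.
- by move=> w _; rewrite mule_ge0.
- by apply: emeasurable_funM.
- apply: measurable_funeM; exact: (m_time_int i mq2 sq0).
move=> w _; rewrite -lamT.
have mqU : measurable_fun setT (fun s => `|q (U i (s, w))|%R).
  by have /measurable_EFinP := mgUs i w mabsq.
apply: le_trans (sqr_integral_le lam mqU _) _ => //.
by under eq_integral do rewrite real_normK ?num_real//.
Qed.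

(** Since [fine] sends [+oo] to 0, real-valued time integrals are meaningful only where the integral
    of [|q|] is finite; the second moment bound [AA] makes this almost sure. *)
Let Afin i : {ae P, forall w, A i w \is a fin_num}.
Proof.
have AAi : P.-integrable setT (fun w => A i w * A i w).
  apply/integrableP; split; first exact: emeasurable_funM.
  under eq_integral do rewrite gee0_abs ?mule_ge0//.
  apply: le_lt_trans (AA i) _.
  by rewrite !lte_mul_pinfty// ?lee_fin ?ltW// mule_ge0// ?integral_ge0.
have := integrable_ae measurableT AAi; apply: filterS => w /(_ I).
by move: (A0 i w); case: (A i w).
Qed.

Section part.
Variable g : E -> \bar R.
Hypothesis mg : measurable_fun setT g.
Hypothesis g0 : forall z, 0 <= g z.
Hypothesis gq : forall z, g z <= absq z.

Let time_int0 i w : 0 <= time_int g i w. Proof. exact: integral_ge0. Qed.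

Lemma time_int_le i w : time_int g i w <= A i w.
Proof. by apply: ge0_le_integral => //; exact: mgUs. Qed.

Lemma time_int_fin i w : A i w \is a fin_num -> time_int g i w \is a fin_num.
Proof.
by rewrite !ge0_fin_numE// => /(le_lt_trans (time_int_le i w)).
Qed.

(** True even where the time integral is infinite: [fine] is then 0 and [A i w] is nonnegative. *)
Lemma fine_time_int_le i w : (fine (time_int g i w))%:E <= A i w.
Proof.
have := time_int_le i w; have := time_int0 i w.
by case: (time_int g i w) => [r| |]//= _ _; exact: A0.
Qed.

Lemma m_fine_time_int i : measurable_fun setT (fun w => fine (time_int g i w)).
Proof. by apply: measurableT_comp => //; exact: m_time_int. Qed.

Lemma mean_fine_time_int i :
  (\int[P]_w fine (time_int g i w))%R = fine (mean g).
Proof.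
rewrite /mean -(occ i)// /Rintegral; congr fine.
apply: ge0_ae_eq_integral => //.
- by apply/measurable_EFinP; exact: m_fine_time_int.
- exact: m_time_int.
- by move=> w _; rewrite lee_fin fine_ge0.
- by move=> w _; exact: time_int0.
- have := Afin i; apply: filterS => w Aw _; rewrite fineK// time_int_fin//.
Qed.

Lemma sqr_time_int_integrable i :
  P.-integrable setT (EFin \o (fun w => fine (time_int g i w) ^+ 2)%R).
Proof.
have mg2 : measurable_fun setT (EFin \o (fun w => fine (time_int g i w) ^+ 2)%R).
  by apply/measurable_EFinP; apply: measurable_funX; exact: m_fine_time_int.
apply/integrableP; split => //.
apply: (@le_lt_trans _ _ (L%:E * (L%:E * B))); last first.
  by rewrite !lte_mul_pinfty// ?lee_fin ?ltW// mule_ge0// ?integral_ge0.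
apply: le_trans (AA i); apply: ge0_le_integral => //.
- exact: measurableT_comp.
- by apply: emeasurable_funM.
move=> w _; rewrite gee0_abs ?lee_fin ?sqr_ge0//= expr2 EFinM.
by apply: lee_pmul; rewrite ?lee_fin ?fine_ge0// fine_time_int_le.
Qed.

(** The mean is the same for all copies, but its finiteness is read off from the second moment of
    one of them, hence the index [i]. *)
Lemma mean_fin (i : 'I_N) : mean g \is a fin_num.
Proof.
have /(integrable_sqr_integrable (m_fine_time_int i)) := sqr_time_int_integrable i.
move/(integrable_fin_num measurableT).
rewrite /mean -(occ i)//.
rewrite (@ge0_ae_eq_integral _ _ _ P setT _ (time_int g i))//.
- by apply/measurable_EFinP; exact: m_fine_time_int.
- exact: m_time_int.
- by move=> w _; rewrite lee_fin fine_ge0.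
- have := Afin i; apply: filterS => w Aw _; rewrite /= fineK// time_int_fin//.
Qed.

End part.

Lemma mean_mul_fine_time_int (g h : E -> \bar R) i j : i != j ->
  measurable_fun setT g -> measurable_fun setT h ->
  (forall z, 0 <= g z) -> (forall z, 0 <= h z) ->
  (forall z, g z <= absq z) -> (forall z, h z <= absq z) ->
  (\int[P]_w (fine (time_int g i w) * fine (time_int h j w)))%R =
  (fine (mean g) * fine (mean h))%R.
Proof.
move=> ij mg mh g0 h0 gq hq.
rewrite -fineM; [|exact: (mean_fin mg g0 gq i)|exact: (mean_fin mh h0 hq i)].
rewrite /mean -(occ i)// -(occ j)//.
rewrite -(@integral_mul_integrals _ _ _ _ _ P lam
  (fun z => g (U i z)) (fun z => h (U j z)))//; last 3 first.
- exact: mgU.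
- exact: mgU.
- by move=> s s'; apply: ind.
congr fine; apply: ge0_ae_eq_integral => //.
- apply/measurable_EFinP; apply: measurable_funM; exact: m_fine_time_int.
- by apply: emeasurable_funM; exact: m_time_int.
- by move=> w _; rewrite lee_fin mulr_ge0// fine_ge0// integral_ge0.
- by move=> w _; rewrite mule_ge0// integral_ge0.
- have := Afin i; have := Afin j; apply: filterS2 => w Ajw Aiw _.
  by rewrite EFinM !fineK// (time_int_fin _ _ _ Aiw, time_int_fin _ _ _ Ajw).
Qed.

Let gp := (EFin \o q)^\+.
Let gm := (EFin \o q)^\-.
Let mgp : measurable_fun setT gp.
Proof. by apply: measurable_funepos; exact/measurable_EFinP. Qed.
Let mgm : measurable_fun setT gm.
Proof. by apply: measurable_funeneg; exact/measurable_EFinP. Qed.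
Let gp0 z : 0 <= gp z. Proof. exact: funepos_ge0. Qed.
Let gm0 z : 0 <= gm z. Proof. exact: funeneg_ge0. Qed.
Let gpq z : gp z <= absq z.
Proof. by rewrite /gp funeposE /absq/= ge_max lee_fin ler_norm lee_fin/=. Qed.
Let gmq z : gm z <= absq z.
Proof.
by rewrite /gm funenegE /absq/= ge_max lee_fin -normrN ler_norm lee_fin/=.
Qed.

Let a i w := fine (time_int gp i w).
Let b i w := fine (time_int gm i w).
(** Off a null set this is the time integral of [q]. Taking [fine] of each part separately makes it
    a difference of square-integrable functions everywhere. *)
Let y i w : R := (a i w - b i w)%R.
Let e : R := (fine (mean gp) - fine (mean gm))%R.

Let ma i : measurable_fun setT (a i). Proof. exact: m_fine_time_int. Qed.
Let mb i : measurable_fun setT (b i). Proof. exact: m_fine_time_int. Qed.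
Let my i : measurable_fun setT (y i). Proof. exact: measurable_funB. Qed.
Let a0 i w : (0 <= a i w)%R. Proof. by apply: fine_ge0; exact: integral_ge0. Qed.
Let b0 i w : (0 <= b i w)%R. Proof. by apply: fine_ge0; exact: integral_ge0. Qed.
Let a2 i : P.-integrable setT (EFin \o (fun w => a i w ^+ 2)%R).
Proof. exact: sqr_time_int_integrable. Qed.
Let b2 i : P.-integrable setT (EFin \o (fun w => b i w ^+ 2)%R).
Proof. exact: sqr_time_int_integrable. Qed.
Let ai i : P.-integrable setT (EFin \o a i).
Proof. exact: integrable_sqr_integrable. Qed.
Let bi i : P.-integrable setT (EFin \o b i).
Proof. exact: integrable_sqr_integrable. Qed.

Let y2 i : P.-integrable setT (EFin \o (fun w => y i w ^+ 2)%R).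
Proof.
apply: (le_integrable _ _ _ (integrableD_EFin (a2 i) (b2 i))) => //.
  by apply/measurable_EFinP; exact: measurable_funX.
move=> w _ /=; rewrite lee_fin !ger0_norm ?sqr_ge0 ?addr_ge0 ?sqr_ge0//.
by have := mulr_ge0 (a0 i w) (b0 i w); rewrite /y !expr2; lra.
Qed.

(** Both [a i w] and [b i w] lie between 0 and [A i w], hence so does the absolute value of their
    difference. Bounding the two squares separately would cost a factor 2. *)
Let y2A i : \int[P]_w (y i w ^+ 2)%:E <= L%:E * (L%:E * B).
Proof.
apply: le_trans (AA i); apply: ge0_le_integral => //.
- by move=> w _; rewrite lee_fin sqr_ge0.
- by apply/measurable_EFinP; exact: measurable_funX.
- by apply: emeasurable_funM.
move=> w _; have := fine_time_int_le mgp gp0 gpq i w.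
have := fine_time_int_le mgm gm0 gmq i w.
rewrite -/(a i w) -/(b i w).
have := A0 i w; case: (A i w) => [r| |//]; last by move=> _ _ _; rewrite mulyy leey.
rewrite !lee_fin -expr2 => r0 br ar.
have := a0 i w; have := b0 i w; rewrite /y => b0' a0'.
by rewrite -[leLHS]real_normK ?num_real// lerXn2r ?nnegrE// ler_norml; apply/andP; split; lra.
Qed.

Let Ey i : (\int[P]_w y i w = e)%R.
Proof. by rewrite RintegralB// !mean_fine_time_int. Qed.

Let Eyy i j : i != j -> (\int[P]_w (y i w * y j w) = e ^+ 2)%R.
Proof.
move=> ij; rewrite (_ : (fun w => _) = (fun w => (a i w * a j w - a i w * b j w) -
    (b i w * a j w - b i w * b j w)))%R; last by apply/funext => w; rewrite /y; ring.
have iM (f g : Om -> R) : measurable_fun setT f -> measurable_fun setT g ->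
    P.-integrable setT (EFin \o (fun w => f w ^+ 2)%R) ->
    P.-integrable setT (EFin \o (fun w => g w ^+ 2)%R) ->
    P.-integrable setT (EFin \o (fun w => f w * g w)%R).
  exact: integrable_sqr_integrableM.
have iaa := iM _ _ (ma i) (ma j) (a2 i) (a2 j).
have iab := iM _ _ (ma i) (mb j) (a2 i) (b2 j).
have iba := iM _ _ (mb i) (ma j) (b2 i) (a2 j).
have ibb := iM _ _ (mb i) (mb j) (b2 i) (b2 j).
rewrite (RintegralB measurableT (integrableB_EFin iaa iab) (integrableB_EFin iba ibb)).
rewrite (RintegralB measurableT iaa iab) (RintegralB measurableT iba ibb).
by rewrite !mean_mul_fine_time_int// /e; ring.
Qed.

Let RintE i w : (\int[lam]_s q (U i (s, w)))%R =
  fine (time_int gp i w - time_int gm i w).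
Proof.
rewrite /Rintegral integralE; congr (fine (_ - _)); apply: eq_integral => s _.
  by rewrite /gp !funeposE.
by rewrite /gm !funenegE.
Qed.

Let mRint i : measurable_fun setT (fun w => \int[lam]_s q (U i (s, w)))%R.
Proof.
rewrite (_ : (fun w => _) = (fun w => fine (time_int gp i w - time_int gm i w))).
  apply: measurableT_comp => //; apply: emeasurable_funB; exact: m_time_int.
by apply/funext => w; exact: RintE.
Qed.

Lemma fixed_kernel_variance :
  \int[P]_w ((\sum_i \int[lam]_s q (U i (s, w)) -
      N%:R * (L * \int[nu]_z (q z * rho z))) ^+ 2)%R%:E <=
  (N%:R * L)%:E * (L%:E * B).
Proof.
(* Because [L > 0], finiteness of the two means passes to the integrals against [rho], so that
   [fine] splits over their difference. *)
have meanE : (L * \int[nu]_z (q z * rho z))%R = e.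
  have mfin (g : E -> \bar R) : mean g \is a fin_num -> \int[nu]_z (g z * (rho z)%:E) \is a fin_num.
    by rewrite /mean; case: (\int[nu]_z _) => [r| |]//=; rewrite ?gt0_muleNy ?gt0_muley ?lte_fin.
  have fp := mfin _ (mean_fin mgp gp0 gpq (Ordinal N0)).
  have fm := mfin _ (mean_fin mgm gm0 gmq (Ordinal N0)).
  rewrite /e /mean !fineM// -mulrBr -fineB//; congr (_ * fine _)%R.
  rewrite integralE; congr (_ - _); apply: eq_integral => z _.
    by rewrite /gp !funeposE maxe_pMl ?mul0e ?lee_fin.
  by rewrite /gm !funenegE maxe_pMl ?mul0e ?mulNe ?lee_fin.
(* Where every [A i w] is finite, [fine] commutes with the difference of the two parts, and the real
   time integrals are exactly the [y i w]. *)
rewrite meanE (@ge0_ae_eq_integral _ _ _ P setT _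
    (fun w => ((\sum_i y i w - N%:R * e) ^+ 2)%:E))//; last 5 first.
- apply/measurable_EFinP; apply: measurable_funX; apply: measurable_funB => //.
  by apply: measurable_sum => i; exact: mRint.
- apply/measurable_EFinP; apply: measurable_funX; apply: measurable_funB => //.
  exact: measurable_sum.
- by move=> w _; rewrite lee_fin sqr_ge0.
- by move=> w _; rewrite lee_fin sqr_ge0.
- have : {ae P, forall w, forall i, A i w \is a fin_num} by exact: filter_forall.
  apply: filterS => w Aw _; congr ((_ - _) ^+ 2)%R%:E; apply: eq_bigr => i _.
  by rewrite RintE fineB// (time_int_fin _ _ _ (Aw i)).
apply: le_trans (uncorrelated_variance_le my y2 Ey Eyy) _.
apply: (@le_trans _ _ (\sum_(i < N) (L%:E * (L%:E * B)))).
  by apply: lee_sum => i _; exact: y2A.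
have Bfin : B \is a fin_num.
  by rewrite ge0_fin_numE// integral_ge0// => z _; rewrite mule_ge0 ?lee_fin ?sqr_ge0.
rewrite -(fineK Bfin) -!EFinM sumEFin sumr_const card_ord lee_fin.
by rewrite -[leLHS]mulr_natl -!mulrA.
Qed.

End fixed_kernel.
End occupation.

Section measurable_Rintegral.
Context d1 d2 (T1 : measurableType d1) (T2 : measurableType d2) (R : realType).

(** Integrability is irrelevant: the value is always [fine] of a difference of two integrals of
    nonnegative functions, each measurable by Tonelli. *)
Lemma measurable_fun_Rintegral (m : {sigma_finite_measure set T2 -> \bar R})
    (f : T1 * T2 -> R) : measurable_fun setT f ->
  measurable_fun setT (fun x => \int[m]_y f (x, y)).
Proof.
move=> /measurable_EFinP mf.
rewrite (_ : (fun x => _) = (fun x =>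
    fine ((\int[m]_y (EFin \o f)^\+ (x, y)) - \int[m]_y (EFin \o f)^\- (x, y))%E)).
  apply: measurableT_comp => //; apply: emeasurable_funB.
    apply: (measurable_fun_fubini_tonelli_F ((EFin \o f)^\+)%E) => //.
    exact: measurable_funepos.
  apply: (measurable_fun_fubini_tonelli_F ((EFin \o f)^\-)%E) => //.
  exact: measurable_funeneg.
apply/funext => x; rewrite /Rintegral integralE.
by congr (fine (_ - _)%E); apply: eq_integral => y _; rewrite ?funeposE ?funenegE.
Qed.

End measurable_Rintegral.

(** * Variance of the averaged estimators, integrated over their argument *)

Section occupation_variance.
Context dO dS dE dT (Om : measurableType dO) (S : measurableType dS)
  (E : measurableType dE) (Th : measurableType dT) (R : realType).
Variables (P : probability Om R) (lam : {finite_measure set S -> \bar R}) (L : R).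
Hypothesis L0 : 0 < L.
Hypothesis lamT : lam setT = L%:E.
Variables (nu : {sigma_finite_measure set E -> \bar R}) (rho : E -> R).
Hypothesis mrho : measurable_fun setT rho.
Hypothesis rho0 : forall z, 0 <= rho z.
Variables (N : nat) (U : 'I_N -> S * Om -> E).
Hypothesis N0 : (0 < N)%N.
Hypothesis mU : forall i, measurable_fun setT (U i).
Local Open Scope ereal_scope.
Hypothesis occ : forall i (g : E -> \bar R), measurable_fun setT g ->
  (forall z, 0 <= g z) ->
  \int[P]_w \int[lam]_s g (U i (s, w)) =
  L%:E * \int[nu]_z (g z * (rho z)%:E).
Hypothesis ind : forall i j, i != j -> forall g h : E -> \bar R,
  measurable_fun setT g -> measurable_fun setT h ->
  (forall z, 0 <= g z) -> (forall z, 0 <= h z) -> forall s s',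
  \int[P]_w (g (U i (s, w)) * h (U j (s', w))) =
  \int[P]_w g (U i (s, w)) * \int[P]_w h (U j (s', w)).

(* When the right-hand side is infinite there is nothing to prove, so no almost
   everywhere argument in the parameter of the kernel is needed later. *)
Lemma averaged_kernel_variance (q : E -> R) : measurable_fun setT q ->
  \int[P]_w (((N%:R * L)^-1 * (\sum_i \int[lam]_s q (U i (s, w))) -
      \int[nu]_z (q z * rho z)) ^+ 2)%R%:E <=
  ((N%:R * L)^-1)%:E * (L%:E * \int[nu]_z ((q z ^+ 2)%:E * (rho z)%:E)).
Proof.
move=> mq; set B := \int[nu]_z _.
have NL0 : (0 < N%:R * L)%R by rewrite mulr_gt0// ltr0n.
have [->|Boo] := eqVneq B +oo.
  by rewrite gt0_muley ?lte_fin// gt0_muley ?lte_fin ?invr_gt0// leey.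
have {}Boo : B < +oo by rewrite lt_neqAle Boo leey.
have NL2 : (0 <= ((N%:R * L)^-1) ^+ 2)%R by rewrite sqr_ge0.
under eq_integral => w _.
  rewrite (_ : (_ ^+ 2)%R = ((N%:R * L)^-1 ^+ 2 *
   (\sum_i \int[lam]_s q (U i (s, w)) - N%:R * (L * \int[nu]_z (q z * rho z))) ^+ 2)%R); last first.
    by rewrite -exprMn mulrBr [in RHS](mulrA N%:R) mulKf// lt0r_neq0.
  rewrite EFinM; over.
have mR i : measurable_fun setT (fun w => \int[lam]_s q (U i (s, w)))%R.
  apply: (@measurable_fun_Rintegral _ _ _ _ _ lam (fun z : Om * S => q (U i (z.2, z.1)))).
  apply: measurableT_comp mq _; apply: measurableT_comp (mU i) _.
  exact: measurable_swap.
rewrite ge0_integralZl//; last 2 first.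
- apply/measurable_EFinP; apply: measurable_funX; apply: measurable_funB => //.
  by apply: measurable_sum => i; exact: mR.
- by move=> w _; rewrite lee_fin sqr_ge0.
apply: le_trans (lee_wpmul2l _ (fixed_kernel_variance L0 lamT rho0 N0 mU occ ind mq Boo)) _.
  by rewrite lee_fin.
rewrite muleA -EFinM expr2 -mulrA mulVf ?mulr1// lt0r_neq0//.
Qed.

Variables (nuT : {sigma_finite_measure set Th -> \bar R}) (q : Th * E -> R) (C : R).
Hypothesis mq : measurable_fun setT q.
Hypothesis qC : forall z, \int[nuT]_x (q (x, z) ^+ 2)%:E <= C%:E.

(** The variance bound at a fixed argument [x] is integrated over [x]. Exchanging the integrals
    brings the one in [x] innermost, where [qC] bounds it by [C] at whatever position the path
    occupies, so the density [rho] disappears from the bound. *)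
Lemma occupation_estimator_variance :
  \int[P]_w \int[nuT]_x (((N%:R * L)^-1 * (\sum_i \int[lam]_s q (x, U i (s, w))) -
      \int[nu]_z (q (x, z) * rho z)) ^+ 2)%R%:E <= (C / N%:R)%:E.
Proof.
have NL0 : (0 < N%:R * L)%R by rewrite mulr_gt0// ltr0n.
have mqU i : measurable_fun setT
    (fun z : Om * Th * S => q (z.1.2, U i (z.2, z.1.1))).
  apply: measurableT_comp mq _; apply: measurable_fun_pair => /=.
    exact: measurableT_comp measurable_snd measurable_fst.
  apply: measurableT_comp (mU i) _; apply: measurable_fun_pair => /=.
    exact: measurable_snd.
  exact: measurableT_comp measurable_fst measurable_fst.
have mq1 x : measurable_fun setT (fun z => q (x, z)).
  exact: measurableT_comp mq (pair1_measurable x).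
have mRi i : measurable_fun setT
    (fun z : Om * Th => \int[lam]_s q (z.2, U i (s, z.1)))%R.
  exact: (measurable_fun_Rintegral lam (mqU i)).
have mc : measurable_fun setT (fun x => \int[nu]_z (q (x, z) * rho z))%R.
  apply: (measurable_fun_Rintegral nu (f := fun z : Th * E => q z * rho z.2)%R).
  by apply: measurable_funM => //; exact: measurableT_comp mrho measurable_snd.
pose F (z : Om * Th) := (((N%:R * L)^-1 * (\sum_i \int[lam]_s q (z.2, U i (s, z.1))) -
      \int[nu]_y (q (z.2, y) * rho y)) ^+ 2)%R%:E.
have mF : measurable_fun setT F.
  apply/measurable_EFinP; apply: measurable_funX; apply: measurable_funB.
    by apply: measurable_funM => //; apply: measurable_sum => i; exact: mRi.
  exact: measurableT_comp mc measurable_snd.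
have F0 z : 0 <= F z by rewrite lee_fin sqr_ge0.
rewrite (fubini_tonelli F)//.
(* Through [occ], the second moment of the kernel against [rho] is rewritten as an expectation along
   a single copy; any index would do. *)
pose i0 := Ordinal N0.
pose G (z : Om * Th * S) := (q (z.1.2, U i0 (z.2, z.1.1)) ^+ 2)%:E.
have mG : measurable_fun setT G.
  by apply/measurable_EFinP; exact: measurable_funX.
have G0 z : 0 <= G z by rewrite lee_fin sqr_ge0.
have mG1 : measurable_fun setT (fun z => \int[lam]_s G (z, s)).
  exact: (measurable_fun_fubini_tonelli_F G).
have G10 z : 0 <= \int[lam]_s G (z, s) by exact: integral_ge0.
apply: (@le_trans _ _ (\int[nuT]_x (((N%:R * L)^-1)%:E *
    \int[P]_w \int[lam]_s G (w, x, s)))).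
  apply: ge0_le_integral => //.
  - by move=> x _; apply: integral_ge0 => w _; rewrite lee_fin sqr_ge0.
  - exact: (measurable_fun_fubini_tonelli_G F).
  - apply: measurable_funeM.
    exact: (measurable_fun_fubini_tonelli_G (fun z : Om * Th => \int[lam]_s G (z, s))).
  - move=> x _; rewrite -[\int[P]_w \int[lam]_s G (w, x, s)]/(\int[P]_w \int[lam]_s
      (fun z => (q (x, z) ^+ 2)%:E) (U i0 (s, w))).
    rewrite (occ i0 (g := fun z => (q (x, z) ^+ 2)%:E)).
    + exact: (averaged_kernel_variance (mq1 x)).
    + by apply/measurable_EFinP; exact: measurable_funX.
    + by move=> z; rewrite lee_fin sqr_ge0.
rewrite ge0_integralZl//; last 3 first.
- exact: (measurable_fun_fubini_tonelli_G (fun z : Om * Th => \int[lam]_s G (z, s))).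
- by move=> x _; apply: integral_ge0 => w _; exact: integral_ge0.
- by rewrite lee_fin invr_ge0 ltW.
rewrite -(fubini_tonelli (fun z : Om * Th => \int[lam]_s G (z, s)))//.
(* The double integral of the constant is [C * L], and this [L] cancels the one in the
   normalization. *)
have -> : (C / N%:R)%:E = ((N%:R * L)^-1)%:E * \int[P]_w \int[lam]_s C%:E.
  have cE : \int[lam]_s C%:E = (C * L)%:E.
    by rewrite -[LHS]/(\int[lam]_s (cst C%:E s)) integral_cst// [X in _ * X]lamT -EFinM.
  under eq_integral do rewrite cE.
  rewrite -[X in _ * X]/(\int[P]_s (cst (C * L)%:E s)) integral_cst//.
  rewrite [X in _ * (_ * X)]probability_setT mule1 -EFinM; congr EFin.
  by field; rewrite !lt0r_neq0// ltr0n.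
apply: lee_wpmul2l; first by rewrite lee_fin invr_ge0 ltW.
have C0 : (0 <= C)%R.
  rewrite -lee_fin; apply: le_trans (qC point).
  by apply: integral_ge0 => x _; rewrite lee_fin sqr_ge0.
apply: ge0_le_integral => //.
- by move=> w _; apply: integral_ge0 => x _; exact: integral_ge0.
- exact: (measurable_fun_fubini_tonelli_F (fun z : Om * Th => \int[lam]_s G (z, s))).
move=> w _.
have mGw : measurable_fun setT (fun z : Th * S => G (w, z.1, z.2)).
  apply: measurableT_comp mG _; apply: measurable_fun_pair => //=.
  by apply: measurable_fun_pair.
rewrite (fubini_tonelli (fun z : Th * S => G (w, z.1, z.2)))//.
apply: ge0_le_integral => //.
- by move=> s _; apply: integral_ge0.
- exact: (measurable_fun_fubini_tonelli_G (fun z : Th * S => G (w, z.1, z.2))).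
- move=> s _; exact: (qC (U i0 (s, w))).
Qed.

End occupation_variance.

(** * Kernels *)

Section norms.
Context (R : realType).
Local Notation mu := (@lebesgue_measure R).
Local Notation Rm := (measurableTypeR R).
Local Open Scope ereal_scope.

Lemma sqr_Lnorm2 d (T : measurableType d) (m : {measure set T -> \bar R}) (g : T -> R) :
  'N[m]_2[EFin \o g] ^+ 2 = \int[m]_x (g x ^+ 2)%:E.
Proof.
have -> : 'N[m]_2[EFin \o g] ^+ 2 = 'N[m]_2[EFin \o g] `^ 2.
  have := Lnorm_ge0 m 2 (EFin \o g); case: ('N[m]_2[_]) => [r| |].
  - by rewrite lee_fin => r0; rewrite poweR_EFin powR_mulrn// -EFin_expe.
  - by move=> _; rewrite poweRyr ?pnatr_eq0// expe2 mulyy.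
  - by [].
rewrite poweR_Lnorm//; apply: eq_integral => x _ /=.
by rewrite powR_mulrn// real_normK ?num_real.
Qed.

Variable K : R -> R.
Hypothesis K2 : K \in Lfun mu 2%:E.

Lemma measurable_kernel : measurable_fun setT K.
Proof. by have := sub_Lfun_mfun K2; rewrite inE. Qed.

Let mK := measurable_kernel.

Lemma kernel_norm_fin : \int[mu]_x (K x ^+ 2)%:E \is a fin_num.
Proof.
rewrite ge0_fin_numE; last by apply: integral_ge0 => x _; rewrite lee_fin sqr_ge0.
have := sub_Lfun_finLfun K2; rewrite inE /finite_norm /= => K2oo.
rewrite -sqr_Lnorm2 expe2; apply: lte_mul_pinfty.
- exact: Lnorm_ge0.
- by rewrite ge0_fin_numE ?Lnorm_ge0.
- exact: K2oo.
Qed.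

Definition kernel_sqnorm : R := fine (\int[mu]_x (K x ^+ 2)%:E).

Lemma kernel_sqnormE : \int[mu]_x (K x ^+ 2)%:E = kernel_sqnorm%:E.
Proof. by rewrite /kernel_sqnorm fineK// kernel_norm_fin. Qed.

Lemma measurable_Kh h : measurable_fun setT (Kh K h).
Proof.
apply: measurable_funM => //; apply: (measurableT_comp mK).
exact: measurable_funM.
Qed.

Lemma sqr_norm_Kh h u : (0 < h)%R ->
  \int[mu]_x (Kh K h (u - x) ^+ 2)%:E = (kernel_sqnorm / h)%:E.
Proof.
move=> h0.
have mK2 : measurable_fun setT (fun x : R => (h^-1 ^+ 2 * K x ^+ 2)%:E).
  by apply/measurable_EFinP; apply: measurable_funM => //; exact: measurable_funX.
have K20 (x : R) : 0 <= (h^-1 ^+ 2 * K x ^+ 2)%:E by rewrite lee_fin mulr_ge0 ?sqr_ge0.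
have KhE x : (Kh K h (u - x) ^+ 2)%:E = (h^-1 ^+ 2 * K ((u - x) / h) ^+ 2)%:E.
  by rewrite /Kh exprMn.
under eq_integral do rewrite KhE.
apply: etrans (ge0_integral_affine u h0 mK2 K20) _.
under eq_integral do rewrite EFinM.
rewrite ge0_integralZl//; last 3 first.
- by apply/measurable_EFinP; exact: measurable_funX.
- by move=> x _; rewrite lee_fin sqr_ge0.
- by rewrite lee_fin sqr_ge0.
rewrite kernel_sqnormE -!EFinM; congr EFin; field; exact: lt0r_neq0.
Qed.

(** The kernel is a product, so Tonelli reduces to two one-dimensional norms, neither of which
    depends on the centre [(u, v)]. *)
Lemma sqr_norm_Qh h1 h2 u v : (0 < h1)%R -> (0 < h2)%R ->
  \int[mu \x mu]_z (Qh K h1 h2 (u - z.1) (v - z.2) ^+ 2)%:E =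
  (kernel_sqnorm ^+ 2 / (h1 * h2))%:E.
Proof.
move=> h10 h20.
have m1 h c : measurable_fun setT (fun x : Rm => Kh K h (c - x)).
  by apply: measurableT_comp (measurable_Kh h) _; exact: measurable_funB.
pose G (z : Rm * Rm) := (Qh K h1 h2 (u - z.1) (v - z.2) ^+ 2)%:E.
have mG : measurable_fun setT G.
  apply/measurable_EFinP; apply: measurable_funX; apply: measurable_funM.
    exact: measurableT_comp (m1 h1 u) measurable_fst.
  exact: measurableT_comp (m1 h2 v) measurable_snd.
have G0 z : 0 <= G z by rewrite lee_fin sqr_ge0.
rewrite (fubini_tonelli1 G)// /fubini_F /G.
under eq_integral => x _.
  under eq_integral do rewrite /= /Qh exprMn EFinM.
  rewrite ge0_integralZl//; last 3 first.
  - by apply/measurable_EFinP; apply: measurable_funX; exact: m1.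
  - by move=> y _; rewrite lee_fin sqr_ge0.
  - by rewrite lee_fin sqr_ge0.
  rewrite sqr_norm_Kh//; over.
rewrite ge0_integralZr//=; last 3 first.
- by apply/measurable_EFinP; apply: measurable_funX; exact: m1.
- by move=> x _; rewrite lee_fin sqr_ge0.
- rewrite lee_fin divr_ge0 ?(ltW h20)// -lee_fin -kernel_sqnormE.
  by apply: integral_ge0 => x _; rewrite lee_fin sqr_ge0.
rewrite sqr_norm_Kh// -EFinM; congr EFin; field.
by rewrite !lt0r_neq0.
Qed.

End norms.

(** * Paths, laws and independence *)

Section joint_measurability.
Context d (Om : measurableType d) (R : realType).
Variables (S : R) (Y : R -> Om -> R) (Om0 : set Om).
Hypothesis S0 : 0 < S.
Hypothesis mY : forall t, measurable_fun setT (Y t).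
Hypothesis mOm0 : measurable Om0.
Hypothesis cY : forall w, Om0 w -> {within `[0, S], continuous (fun t => Y t w)}.

(** Projection of the time line onto [0, S]: paths are continuous only there, while the product with
    [Om] is taken over all real times. *)
Definition clamp (s : R) : R := Num.min S (Num.max 0 s).

Lemma clamp_itv s : 0 <= clamp s <= S.
Proof.
rewrite /clamp ge_min lexx/= andbT le_min (ltW S0)/= le_max lexx//.
Qed.

Lemma clamp_id s : 0 <= s <= S -> clamp s = s.
Proof.
by move=> /andP[s0 sS]; rewrite /clamp (max_idPr s0) (min_idPr sS).
Qed.

Lemma measurable_clamp : measurable_fun setT clamp.
Proof. by apply: measurable_minr => //; exact: measurable_maxr. Qed.

(* The left endpoint of the cell of mesh [S / n.+1] that contains [clamp s]. *)
Let grid (n : nat) (s : R) : R :=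
  S * (Num.truncn (n.+1%:R * (clamp s / S)))%:R / n.+1%:R.

Let ratio_itv s : 0 <= clamp s / S <= 1.
Proof.
have /andP[c0 cS] := clamp_itv s.
by rewrite divr_ge0 ?(ltW S0)//= ler_pdivrMr// mul1r.
Qed.

Let grid_close n s : clamp s - S / n.+1%:R <= grid n s <= clamp s.
Proof.
have /andP[r0 r1] := ratio_itv s.
have n0 : (0 : R) < n.+1%:R by rewrite ltr0n.
have := truncn_itv (mulr_ge0 (ltW n0) r0) => /andP[tl tu].
rewrite /grid; set k := Num.truncn _ in tl tu *.
have cE : clamp s = S * (n.+1%:R * (clamp s / S)) / n.+1%:R.
  by field; rewrite !lt0r_neq0.
apply/andP; split; last first.
  by rewrite [leRHS]cE ler_pM2r ?invr_gt0// ler_pM2l.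
rewrite [X in X - _]cE -mulrBl ler_pM2r ?invr_gt0// -[X in _ - X]mulr1 -mulrBr.
rewrite ler_pM2l// lerBlDr ltW// (lt_le_trans tu)//.
by rewrite -natr1.
Qed.

Let grid_itv n s : 0 <= grid n s <= S.
Proof.
have /andP[_ gc] := grid_close n s.
have /andP[_ cS] := clamp_itv s.
rewrite (le_trans gc cS) andbT /grid divr_ge0// mulr_ge0// ltW//.
Qed.

Let grid_cvg s : (fun n => grid n s) @ \oo --> clamp s.
Proof.
apply: (@squeeze_cvgr _ _ _ _ (fun n => clamp s - S / n.+1%:R) (cst (clamp s))).
- by near=> n; exact: grid_close.
- rewrite -[X in _ --> X]subr0; apply: cvgB; first exact: cvg_cst.
  rewrite -(mulr0 S); apply: cvgMr => //; first exact: cvg_harmonic.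
- exact: cvg_cst.
Unshelve. all: by end_near. Qed.

(** Sampling the path at the left endpoint of each cell gives a finite sum of products of a function
    of time and a function of [w]; continuity gives pointwise convergence as the mesh tends to 0.
    The factor [\1_Om0] removes the paths for which this convergence may fail. *)
Lemma measurable_joint :
  measurable_fun setT (fun z : R * Om => Y (clamp z.1) z.2 * \1_Om0 z.2).
Proof.
(* There are [n.+2] cells because at [clamp z.1 = S] the rescaled time equals [n.+1], which opens
   one more cell. *)
pose h n (z : R * Om) : R := (\sum_(k < n.+2) Y (S * k%:R / n.+1%:R) z.2 *
  \1_(`[k%:R, k.+1%:R[%classic : set R) (n.+1%:R * (clamp z.1 / S))) * \1_Om0 z.2.
have hE n z : h n z = Y (grid n z.1) z.2 * \1_Om0 z.2.
  rewrite /h; congr (_ * _).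
  have /andP[r0 r1] := ratio_itv z.1.
  set x := n.+1%:R * (clamp z.1 / S).
  have x0 : 0 <= x by rewrite mulr_ge0.
  have xn : (Num.truncn x < n.+2)%N.
    rewrite truncn_lt_nat// (@le_lt_trans _ _ n.+1%:R) ?ltr_nat//.
    by rewrite -[leRHS]mulr1 ler_pM2l// ltr0n.
  rewrite (bigD1 (Ordinal xn))//= [X in _ + X]big1 ?addr0.
    rewrite indicE mem_set ?mulr1//=.
    by rewrite in_itv/= truncn_itv.
  move=> k kx; rewrite indicE memNset ?mulr0//= in_itv/= => /truncn_def kE.
  by move: kx; rewrite -val_eqE/= kE eqxx.
apply: (@measurable_fun_cvg _ _ _ _ h).
- move=> n; apply: measurable_funM; last first.
    have mI : measurable_fun setT (\1_Om0 : Om -> R) by exact: measurable_indic.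
    exact: measurableT_comp mI measurable_snd.
  apply: measurable_sum => k; apply: measurable_funM.
    exact: measurableT_comp (mY _) measurable_snd.
  have mI : measurable_fun setT (\1_(`[k%:R, k.+1%:R[%classic : set R) : R -> R).
    exact: measurable_indic.
  apply: measurableT_comp mI _.
  apply: measurable_funM => //; apply: measurable_funM => //.
  exact: measurableT_comp measurable_clamp measurable_fst.
- move=> z _; under eq_fun do rewrite hE.
  rewrite indicE; case: (boolP (z.2 \in Om0)) => [|_]; last first.
    by rewrite mulr0; under eq_fun do rewrite mulr0; exact: cvg_cst.
  rewrite inE mulr1 => zO; under eq_fun do rewrite mulr1.
  have /subspace_continuousP/(_ (clamp z.1)) := cY zO.
  move=> /(_ _)/wrap[|c]; first by rewrite /= in_itv/= clamp_itv.
  apply: cvg_comp c => B /=.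
  move=> /(@grid_cvg z.1 _)[M _ MB]; exists M => // n Mn; apply: (MB n Mn).
  by rewrite /= in_itv/= grid_itv.
Qed.

End joint_measurability.

Section laws.
Context d1 d2 (T1 : measurableType d1) (T2 : measurableType d2) (R : realType).
Local Open Scope ereal_scope.

(** Rectangles form a generating family stable under intersection, and finiteness of [m1] lets the
    constant sequence [setT] serve as exhaustion. *)
Lemma eq_measure_rectangles (m1 m2 : {measure set (T1 * T2) -> \bar R}) :
  m1 setT < +oo ->
  (forall A B, measurable A -> measurable B -> m1 (A `*` B) = m2 (A `*` B)) ->
  forall X, measurable X -> m1 X = m2 X.
Proof.
move=> m1oo m12 X mX.
pose C : set (set (T1 * T2)) :=
  [set C | exists A, measurable A /\ exists B, measurable B /\ C = A `*` B].
apply: (measure_unique C (fun=> setT)) => //.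
- rewrite measurable_prod_measurableType //; congr (<<s _ >>).
  rewrite predeqE; split => [[A mA [B mB <-]]|[A [mA [B [mB ->]]]]].
    by exists A; split => //; exists B.
  by exists A => //; exists B.
- move=> /= _ _ [X1 [mX1 [X2 [mX2 ->]]]] [Y1 [mY1 [Y2 [mY2 ->]]]].
  rewrite -setXI; exists (X1 `&` Y1); split; first exact: measurableI.
  by exists (X2 `&` Y2); split => //; exact: measurableI.
- by move=> n; exists setT; split => //; exists setT; rewrite setXTT.
- by rewrite bigcup_const.
- by move=> _ [A [mA [B [mB ->]]]]; exact: m12.
Qed.

Lemma ge0_integral_law (P : {measure set T1 -> \bar R}) (V : T1 -> T2)
    (mu : {measure set T2 -> \bar R}) (rho : T2 -> R) :
  measurable_fun setT V -> measurable_fun setT rho -> (forall z, (0 <= rho z)%R) ->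
  (forall A, measurable A -> P (V @^-1` A) = \int[mu]_(z in A) (rho z)%:E) ->
  forall g : T2 -> \bar R, measurable_fun setT g -> (forall z, 0 <= g z) ->
  \int[P]_w g (V w) = \int[mu]_z (g z * (rho z)%:E).
Proof.
move=> mV mrho rho0 lawV g mg g0.
have [nu nuE] : exists nu : {measure set T2 -> \bar R}, forall A, nu A = P (V @^-1` A).
  by unshelve eexists; first refine (pushforward P V : {measure set T2 -> \bar R}).
rewrite -(@ge0_integral_density _ _ _ mu nu)//; last by move=> A mA; rewrite nuE lawV.
transitivity (\int[pushforward P V]_z g z).
  by rewrite ge0_integral_pushforward// preimage_setT.
by apply: eq_measure_integral => A _ _; rewrite nuE.
Qed.

Variables (mu : {measure set T1 -> \bar R}) (rho : T1 -> R).
Hypothesis mrho : measurable_fun setT rho.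
Hypothesis rho0 : forall z, (0 <= rho z)%R.

Lemma density_measure_exists :
  exists nu : {measure set T1 -> \bar R},
    forall A, measurable A -> nu A = \int[mu]_(z in A) (rho z)%:E.
Proof.
pose nu (A : set T1) := \int[mu]_(z in A) (rho z)%:E.
have nu0 : nu set0 = 0 by rewrite /nu integral_set0.
have nuge0 A : 0 <= nu A by apply: integral_ge0 => x _; rewrite lee_fin.
have nusigma : semi_sigma_additive nu.
  move=> F mF tF mUF; rewrite /nu ge0_integral_bigcup//.
  - by apply: is_cvg_nneseries => n _ _; exact: nuge0.
  - by apply/measurable_EFinP; exact: measurable_funTS.
  - by move=> x _; rewrite lee_fin.
pose mx := isMeasure.Build _ _ _ nu nu0 nuge0 nusigma.
pose nu' : {measure set T1 -> \bar R} := HB.pack nu mx.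
by exists nu'.
Qed.

End laws.

Lemma natural_filtration_setT (R : realType) d (Om : measurableType d)
    (P : probability Om R) (Y : R -> {RV P >-> R}) s : natural_filtration Y s setT.
Proof.
have [H0 HC _] := smallest_sigma_algebra setT (events_before Y s).
by have := HC _ H0; rewrite setD0.
Qed.

(** * One-time and two-time laws of the diffusion and of its copies *)

Section markov_laws.
Context (R : realType) d (Om : measurableType d) (P : probability Om R).
Local Notation mu := (@lebesgue_measure R).
Local Notation Rm := (measurableTypeR R).
Variables (S x0 : R) (X Y : R -> {RV P >-> R}) (p : R -> R -> R -> R).
Hypothesis hp : markov_transition_density S X p.
Hypothesis X0 : {ae P, forall w, X 0 w = x0}.
Hypothesis XY : same_law S Y X.
Local Open Scope ereal_scope.

(** Extending [p] by 0 to times outside ]0, S] turns the measurability on a subset, provided by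
    [hp], into measurability on the whole product, as Tonelli requires. *)
Lemma measurable_transition : measurable_fun setT (fun z : R * R * R =>
  (p z.1.1 z.1.2 z.2 * \1_(`]0, S]%classic : set R) z.1.1)%R).
Proof.
pose D := [set z : R * R * R | (0 < z.1.1 <= S)%R].
have m11 : measurable_fun setT (fun z : R * R * R => z.1.1).
  exact: measurableT_comp measurable_fst measurable_fst.
have DE : D = (fun z : R * R * R => z.1.1) @^-1` `]0%R, S].
  by apply/seteqP; split=> z /=; rewrite in_itv.
have mD : measurable D by rewrite DE -[X in measurable X]setTI; exact: m11.
have := td_measurable hp; rewrite -/D (measurable_restrictT _ mD).
congr (measurable_fun _ _); apply/funext => z.
rewrite patchE indicE; case: ifPn => zD.
  rewrite mem_set ?mulr1//=; move: zD; rewrite inE.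
  by rewrite /D /= in_itv.
rewrite memNset ?mulr0//=; move: zD; rewrite notin_setE.
by rewrite /D /= in_itv.
Qed.

Lemma measurable_transition_t t : (0 < t <= S)%R ->
  measurable_fun setT (fun z : R * R => p t z.1 z.2).
Proof.
move=> tS; rewrite (_ : (fun z => _) = (fun z : R * R * R =>
  (p z.1.1 z.1.2 z.2 * \1_(`]0, S]%classic : set R) z.1.1)%R) \o
   (fun z : R * R => (t, z.1, z.2))); last first.
  by apply/funext => z /=; rewrite indicE mem_set ?mulr1//= in_itv.
apply: measurableT_comp measurable_transition _.
apply: measurable_fun_pair => //; apply: measurable_fun_pair => //.
Qed.

Lemma measurable_transition_tx t x : (0 < t <= S)%R ->
  measurable_fun setT (p t x).
Proof.
move=> tS; exact: measurableT_comp (measurable_transition_t tS) (pair1_measurable x).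
Qed.

(** This is the Markov property at time 0 with the event [setT], followed by replacing [X 0 w] by
    its almost sure value [x0]. *)
Lemma marginal_law s (A : set R) : (0 < s <= S)%R -> measurable A ->
  P (X s @^-1` A) = \int[mu]_(y in A) (p s x0 y)%:E.
Proof.
move=> sS mA; have /andP[s0 sS'] := sS.
have := td_markov hp (lexx 0%R) s0 _ (@natural_filtration_setT R _ Om P X 0%R) mA.
rewrite add0r => /(_ sS'); rewrite setTI => ->.
have mpt := measurable_transition_t sS.
have p0 x y : 0 <= (p s x y)%:E by rewrite lee_fin (td_ge0 hp).
rewrite (@ge0_ae_eq_integral _ _ _ P setT _ (cst (\int[mu]_(y in A) (p s x0 y)%:E)))//.
- by rewrite integral_cst// [X in _ * X]probability_setT mule1.
- pose F z := (p s z.1 z.2 * \1_A z.2)%:E.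
  have mF : measurable_fun setT F.
    apply/measurable_EFinP; apply: measurable_funM => //.
    have mI : measurable_fun setT (\1_A : R -> R) by exact: measurable_indic.
    exact: measurableT_comp mI measurable_snd.
  have F0 z : 0 <= F z by rewrite lee_fin mulr_ge0// (td_ge0 hp).
  rewrite (_ : (fun w => _) = (fun x => \int[mu]_y F (x, y)) \o X 0%R).
    have mk : measurable_fun setT (fun x => \int[mu]_y F (x, y)).
      exact: (@measurable_fun_fubini_tonelli_F _ _ R Rm R mu F mF F0).
    exact: measurableT_comp mk _.
  apply/funext => w /=; rewrite [LHS]integral_mkcond; apply: eq_integral => y _.
  by rewrite epatch_indic -EFinM.
- by move=> w _; exact: integral_ge0.
- by move=> w _; exact: integral_ge0.
- by move: X0; apply: filterS => w -> _.
Qed.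

Lemma ge0_integral_marginal s (g : R -> \bar R) : (0 < s <= S)%R ->
  measurable_fun setT g -> (forall x, 0 <= g x) ->
  \int[P]_w g (X s w) = \int[mu]_x (g x * (p s x0 x)%:E).
Proof.
move=> sS; apply: (@ge0_integral_law _ _ Om Rm R P (X s) mu (p s x0)) => //.
- exact: (measurable_funPT (X s)).
- exact: measurable_transition_tx.
- by move=> z; rewrite (td_ge0 hp).
- by move=> A mA; exact: marginal_law.
Qed.

Lemma ge0_integral_marginal_copy s (g : R -> \bar R) : (0 < s <= S)%R ->
  measurable_fun setT g -> (forall x, 0 <= g x) ->
  \int[P]_w g (Y s w) = \int[mu]_x (g x * (p s x0 x)%:E).
Proof.
move=> sS; apply: (@ge0_integral_law _ _ Om Rm R P (Y s) mu (p s x0)) => //.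
- exact: (measurable_funPT (Y s)).
- exact: measurable_transition_tx.
- by move=> z; rewrite (td_ge0 hp).
move=> A mA; rewrite -marginal_law//.
have capE (V : R -> {RV P >-> R}) : V s @^-1` A = \bigcap_(k : 'I_1) (V s @^-1` A).
  by apply/seteqP; split => [w Aw k _//|w /(_ ord0 I)].
rewrite [LHS](congr1 P (capE Y)) [RHS](congr1 P (capE X)).
apply: (XY (u := fun=> s) (B := fun=> A)) => // _.
by have /andP[/ltW -> ->] := sS.
Qed.

(** The Markov property is stated for [X], so the probability of a rectangle is first transferred
    from [Y] to [X] by [same_law] with two times. The Markov property at time [s], for the event
    that [X s] lies in [A], and the law of [X s] then give the density; rectangles determine the
    joint law. *)
Lemma ge0_integral_pair_copy s t (g : R * R -> \bar R) :
  (0 < s)%R -> (0 < t)%R -> (s + t <= S)%R ->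
  measurable_fun setT g -> (forall x, 0 <= g x) ->
  \int[P]_w g (Y s w, Y (s + t)%R w) =
  \int[mu \x mu]_z (g z * (p s x0 z.1 * p t z.1 z.2)%:E).
Proof.
move=> s0 t0 stS mg g0.
have sS : (0 < s <= S)%R by rewrite s0 (le_trans _ stS)// lerDl ltW.
have tS : (0 < t <= S)%R by rewrite t0 (le_trans _ stS)// lerDr ltW.
have mps := measurable_transition_tx x0 sS.
have mpt := measurable_transition_t tS.
have ps0 x : (0 <= p s x0 x)%R by rewrite (td_ge0 hp).
have pt0 x y : (0 <= p t x y)%R by rewrite (td_ge0 hp).
pose rho z := (p s x0 z.1 * p t z.1 z.2)%R.
have mrho : measurable_fun setT rho.
  by apply: measurable_funM => //; exact: measurableT_comp mps measurable_fst.
have rho0 z : (0 <= rho z)%R by rewrite mulr_ge0.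
pose V w := (Y s w, Y (s + t)%R w).
have mV : measurable_fun setT V by exact: measurable_fun_pair.
apply: (@ge0_integral_law _ _ Om (Rm * Rm)%type R P V (mu \x mu) rho) => //.
have [nu nuE] := @density_measure_exists _ _ _ (mu \x mu)%E rho mrho rho0.
have [la laE] : exists la : {measure set (Rm * Rm) -> \bar R}, forall A, la A = P (V @^-1` A).
  by unshelve eexists; first refine
    (pushforward P (V : Om -> Rm * Rm)%type : {measure set (Rm * Rm) -> \bar R}).
move=> A mA; transitivity (la A); first by rewrite laE.
transitivity (nu A); last by rewrite nuE.
apply: (@eq_measure_rectangles _ _ Rm Rm R la nu _ _ A mA).
  by rewrite laE preimage_setT probability_setT ltry.
move=> {mA}{}A B mA mB; rewrite laE nuE; last exact: measurableX.
transitivity (P (X s @^-1` A `&` X (s + t)%R @^-1` B)).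
  pose u (k : 'I_2) := if k == ord0 then s else (s + t)%R.
  pose C (k : 'I_2) := if k == ord0 then A else B.
  have capE (Z : R -> {RV P >-> R}) : \bigcap_k (Z (u k) @^-1` C k) =
      Z s @^-1` A `&` Z (s + t)%R @^-1` B.
    apply/seteqP; split => [w H|w [Aw Bw] k _].
      by split; [exact: (H ord0)|exact: (H (lift ord0 ord0))].
    by rewrite /u /C /preimage/=; case: ifPn.
  rewrite -capE -(XY (u := u) (B := C)).
  - by rewrite capE.
  - move=> k; rewrite /u; case: ifPn => _; first by rewrite (ltW s0)/=; case/andP: sS.
    by rewrite addr_ge0//= ?ltW.
  - by move=> k; rewrite /C; case: ifPn.
have natX : natural_filtration X s (X s @^-1` A).
  apply: sub_sigma_algebra; exists s, A; split => //.
  by rewrite ltW//= lexx.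
rewrite (td_markov hp (ltW s0) t0 stS natX mB).
pose k x := \int[mu]_(y in B) (p t x y)%:E.
have k0 x : 0 <= k x by apply: integral_ge0 => y _; rewrite lee_fin.
have mI (D : set R) : measurable D -> measurable_fun setT (\1_D : R -> R).
  by move=> mD; exact: measurable_indic.
pose F z := (p t z.1 z.2 * \1_B z.2)%:E.
have mF : measurable_fun setT F.
  apply/measurable_EFinP; apply: measurable_funM => //.
  exact: measurableT_comp (mI _ mB) measurable_snd.
have F0 z : 0 <= F z by rewrite lee_fin mulr_ge0.
have kE x : k x = \int[mu]_y F (x, y).
  rewrite /k [LHS]integral_mkcond; apply: eq_integral => y _.
  by rewrite epatch_indic -EFinM.
have mk : measurable_fun setT k.
  rewrite (_ : k = fun x => \int[mu]_y F (x, y)); last exact/funext.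
  exact: (@measurable_fun_fubini_tonelli_F _ _ R Rm R mu F mF F0).
pose g' x := k x * (\1_A x)%:E.
have g'0 x : 0 <= g' x by rewrite mule_ge0// lee_fin.
have mg' : measurable_fun setT g'.
  by apply: emeasurable_funM => //; apply/measurable_EFinP; exact: mI.
transitivity (\int[P]_w g' (X s w)).
  by rewrite integral_mkcond; apply: eq_integral => w _; rewrite epatch_indic.
rewrite ge0_integral_marginal// [RHS]integral_mkcond.
pose H (z : Rm * Rm) := (p s x0 z.1 * \1_A z.1)%:E * F z.
have mH : measurable_fun setT H.
  apply: emeasurable_funM => //; apply/measurable_EFinP.
  apply: measurable_funM; first exact: measurableT_comp mps measurable_fst.
  exact: measurableT_comp (mI _ mA) measurable_fst.
have H0 z : 0 <= H z by rewrite mule_ge0// lee_fin mulr_ge0.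
transitivity (\int[mu \x mu]_z H z); last first.
  apply: eq_integral => -[x y] _; rewrite epatch_indic /H /F/= /rho -!EFinM; congr EFin.
  have -> : \1_(A `*` B) (x, y) = (\1_A x * \1_B y)%R :> R.
    by rewrite !indicE in_setX/=; case: (_ \in A); case: (_ \in B); rewrite ?mulr1 ?mulr0.
  by rewrite /=; ring.
rewrite (fubini_tonelli1 H)//; apply: eq_integral => x _.
rewrite /fubini_F /H /= ge0_integralZl//; last 2 first.
- exact: measurableT_comp mF (pair1_measurable x).
- by rewrite lee_fin mulr_ge0.
rewrite -[X in _ = _ * X]kE /g' [RHS]muleC -muleA; congr (_ * _).
by rewrite EFinM muleC.
Qed.

End markov_laws.

Section independence.
Context (R : realType) d (Om : measurableType d) (P : probability Om R).
Local Open Scope ereal_scope.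

(** The assumption on rectangles identifies the law of [(V1, V2)] with the product of the two laws,
    under which Tonelli splits the integral. *)
Lemma ge0_integral_indep d1 d2 (T1 : measurableType d1) (T2 : measurableType d2)
    (V1 : Om -> T1) (V2 : Om -> T2) :
  measurable_fun setT V1 -> measurable_fun setT V2 ->
  (forall A B, measurable A -> measurable B ->
    P (V1 @^-1` A `&` V2 @^-1` B) = P (V1 @^-1` A) * P (V2 @^-1` B)) ->
  forall (g : T1 -> \bar R) (h : T2 -> \bar R),
  measurable_fun setT g -> measurable_fun setT h ->
  (forall z, 0 <= g z) -> (forall z, 0 <= h z) ->
  \int[P]_w (g (V1 w) * h (V2 w)) = \int[P]_w g (V1 w) * \int[P]_w h (V2 w).
Proof.
move=> mV1 mV2 V12 g h mg mh g0 h0.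
pose W1 : {mfun Om >-> T1} := HB.pack V1 (isMeasurableFun.Build _ _ _ _ _ mV1).
pose W2 : {mfun Om >-> T2} := HB.pack V2 (isMeasurableFun.Build _ _ _ _ _ mV2).
pose m1 := distribution P W1.
pose m2 := distribution P W2.
pose V w := (V1 w, V2 w).
have mV : measurable_fun setT V by exact: measurable_fun_pair.
pose G (z : T1 * T2) := g z.1 * h z.2.
have mG : measurable_fun setT G.
  by apply: emeasurable_funM;
    [exact: measurableT_comp mg measurable_fst|exact: measurableT_comp mh measurable_snd].
have G0 z : 0 <= G z by rewrite mule_ge0.
have [la laE] : exists la : {measure set (T1 * T2) -> \bar R}, forall A, la A = P (V @^-1` A).
  by unshelve eexists; first refine (pushforward P V : {measure set (T1 * T2) -> \bar R}).
transitivity (\int[pushforward P V]_z G z).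
  by rewrite ge0_integral_pushforward// preimage_setT.
transitivity (\int[m1 \x m2]_z G z).
  apply: eq_measure_integral => A mA _.
  have E : (m1 \x m2)%E A = la A.
    apply: product_measure_unique mA => B C mB mC; rewrite laE; exact: V12.
  by rewrite /= [RHS]E laE.
have distE d' (T' : measurableType d') (W' : {mfun Om >-> T'}) (k : T' -> \bar R) :
    measurable_fun setT k -> (forall z, 0 <= k z) ->
    \int[distribution P W']_z k z = \int[P]_w k (W' w).
  by move=> mk k0; rewrite ge0_integral_pushforward// preimage_setT.
rewrite (fubini_tonelli1 G)// /fubini_F /G/=.
under eq_integral => x _ do rewrite ge0_integralZl//.
rewrite ge0_integralZr//; last exact: integral_ge0.
by rewrite !distE.
Qed.

(** The other members of the family are given the event [setT], which has probability 1. *)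
Lemma independent_pair N (G : 'I_N -> set (set Om)) (i j : 'I_N) (A B : set Om) :
  independent P G -> (forall k, G k setT) -> i != j -> G i A -> G j B ->
  P (A `&` B) = P A * P B.
Proof.
move=> indG GT ij GA GB.
pose E k := if k == i then A else if k == j then B else setT.
have GE k : G k (E k).
  by rewrite /E; case: eqP => [->//|_]; case: eqP => [->//|_].
have := indG E GE.
have -> : \bigcap_k E k = A `&` B.
  apply/seteqP; split => [w H|w [Aw Bw] k _].
    split; first by have := H i I; rewrite /E eqxx.
    by have := H j I; rewrite /E eqxx eq_sym (negbTE ij).
  by rewrite /E; case: ifP => // _; case: ifP.
move=> ->; rewrite (bigD1 i)//= (bigD1 j)/=; last by rewrite eq_sym.
rewrite big1; last first.
  by move=> k /andP[ki kj]; rewrite /E (negbTE ki) (negbTE kj) probability_setT.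
by rewrite mule1 /E eqxx eq_sym (negbTE ij) eqxx.
Qed.

Local Notation Rm := (measurableTypeR R).

(** With [Om] equipped with the sigma-algebra generated by the events up to [S], each coordinate is
    measurable by construction, hence so is the pair. *)
Lemma natural_filtration_pair (Y : R -> {RV P >-> R}) (S a b : R) (C : set (Rm * Rm)) :
  (0 <= a <= S)%R -> (0 <= b <= S)%R -> measurable C ->
  natural_filtration Y S ((fun w => (Y a w, Y b w)) @^-1` C).
Proof.
move=> aS bS mC.
pose Omg := g_sigma_algebraType (events_before Y S).
have mY c : (0 <= c <= S)%R -> measurable_fun setT (Y c : Omg -> Rm).
  move=> cS _ B mB; rewrite setTI; apply: sub_sigma_algebra.
  by exists c, B.
have mV : measurable_fun setT ((fun w => (Y a w, Y b w)) : Omg -> (Rm * Rm)%type).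
  by apply: measurable_fun_pair; exact: mY.
by have := mV measurableT _ mC; rewrite setTI.
Qed.

Lemma ge0_integral_indep_pair N (Xi : 'I_N -> R -> {RV P >-> R}) (S : R)
    (i j : 'I_N) (a b a' b' : R) (g h : Rm * Rm -> \bar R) :
  independent P (fun i => natural_filtration (Xi i) S) -> i != j ->
  (0 <= a <= S)%R -> (0 <= b <= S)%R -> (0 <= a' <= S)%R -> (0 <= b' <= S)%R ->
  measurable_fun setT g -> measurable_fun setT h ->
  (forall z, 0 <= g z) -> (forall z, 0 <= h z) ->
  \int[P]_w (g (Xi i a w, Xi i b w) * h (Xi j a' w, Xi j b' w)) =
  \int[P]_w g (Xi i a w, Xi i b w) * \int[P]_w h (Xi j a' w, Xi j b' w).
Proof.
move=> indX ij aS bS aS' bS' mg mh g0 h0.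
apply: (@ge0_integral_indep _ _ (Rm * Rm)%type (Rm * Rm)%type
  (fun w => (Xi i a w, Xi i b w)) (fun w => (Xi j a' w, Xi j b' w))) => //.
- by apply: measurable_fun_pair;
    [exact: (measurable_funPT (Xi i a))|exact: (measurable_funPT (Xi i b))].
- by apply: measurable_fun_pair;
    [exact: (measurable_funPT (Xi j a'))|exact: (measurable_funPT (Xi j b'))].
move=> A B mA mB; apply: independent_pair indX _ ij _ _.
- by move=> k; exact: natural_filtration_setT.
- exact: natural_filtration_pair.
- exact: natural_filtration_pair.
Qed.

End independence.

Section occupation_formula.
Context dO dS dE (Om : measurableType dO) (S : measurableType dS)
  (E : measurableType dE) (R : realType).
Variables (P : probability Om R) (lam : {sigma_finite_measure set S -> \bar R}).
Variables (nu : {sigma_finite_measure set E -> \bar R}).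
Variables (U : S * Om -> E) (r : S * E -> R) (rho : E -> R) (D : set S) (L : R).
Local Open Scope ereal_scope.
Hypothesis mU : measurable_fun setT U.
Hypothesis mr : measurable_fun setT r.
Hypothesis r0 : forall z, (0 <= r z)%R.
Hypothesis mD : measurable D.
Hypothesis lamD : lam (~` D) = 0.
Hypothesis L0 : (0 <= L)%R.
Hypothesis rho0 : forall z, (0 <= rho z)%R.
Hypothesis mrho : measurable_fun setT rho.
Hypothesis rhoE : forall z, \int[lam]_s (r (s, z))%:E = (L * rho z)%:E.

(** Here [r (s, z)] is the density at time [s] and [rho] its time average. Tonelli is used once on
    each side of the substitution of the fixed-time law, which is available on [D], a set of full
    [lam] measure. *)
Lemma occupation_formula (g : E -> \bar R) :
  measurable_fun setT g -> (forall z, 0 <= g z) ->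
  (forall s, D s -> \int[P]_w g (U (s, w)) = \int[nu]_z (g z * (r (s, z))%:E)) ->
  \int[P]_w \int[lam]_s g (U (s, w)) = L%:E * \int[nu]_z (g z * (rho z)%:E).
Proof.
move=> mg g0 gU.
have mgU : measurable_fun setT (fun z => g (U z)) by exact: measurableT_comp.
pose F (z : S * E) := g z.2 * (r z)%:E.
have mF : measurable_fun setT F.
  apply: emeasurable_funM; first exact: measurableT_comp mg measurable_snd.
  exact/measurable_EFinP.
have F0 z : 0 <= F z by rewrite mule_ge0// lee_fin.
rewrite -(fubini_tonelli (fun z => g (U z)))//.
rewrite (@ge0_ae_eq_integral _ _ _ lam setT _ (fun s => \int[nu]_z F (s, z)))//; last 5 first.
- exact: (measurable_fun_fubini_tonelli_F (fun z => g (U z))).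
- exact: (measurable_fun_fubini_tonelli_F F).
- by move=> s _; exact: integral_ge0.
- by move=> s _; exact: integral_ge0.
- exists (~` D); split => //; first exact: measurableC.
  move=> s /=; apply: contra_not => Ds _; exact: gU.
rewrite (fubini_tonelli F)// -ge0_integralZl//; last first.
- by move=> z _; rewrite mule_ge0// lee_fin.
- by apply: emeasurable_funM => //; exact/measurable_EFinP.
apply: eq_integral => z _; rewrite /F/= ge0_integralZl//; last 2 first.
- apply/measurable_EFinP; exact: measurableT_comp mr (pair2_measurable z).
- by move=> s _; rewrite lee_fin.
by rewrite rhoE muleCA -EFinM.
Qed.

End occupation_formula.

(** * Occupation measure of the diffusion *)

Section good_paths.
Context (R : realType) d (Om : measurableType d) (P : probability Om R).

Lemma continuous_paths_set (S : R) N (Xi : 'I_N -> R -> {RV P >-> R}) :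
  (forall i, continuous_paths S (Xi i)) ->
  exists Om0, [/\ measurable Om0, P (~` Om0) = 0%E & forall w, Om0 w ->
    forall i, {within `[0, S], continuous (fun t => Xi i t w)}].
Proof.
move=> cX.
have : {ae P, forall w, forall i, {within `[0, S], continuous (fun t => Xi i t w)}}.
  exact: filter_forall.
move=> [A [mA A0 cA]]; exists (~` A); split.
- exact: measurableC.
- by rewrite setCK.
- by move=> w /= nAw; apply: contrapT => nc; apply: nAw; exact: cA.
Qed.

End good_paths.

Section diffusion_occupation.
Context (R : realType) d (Om : measurableType d) (P : probability Om R).
Local Notation mu := (@lebesgue_measure R).
Local Notation Rm := (measurableTypeR R).
Variables (T x0 t0 t M : R) (X : R -> {RV P >-> R}) (p : R -> R -> R -> R).
Hypothesis t0T : 0 < t0 < T.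
Hypothesis tT : 0 < t <= T.
Hypothesis hp : markov_transition_density (2 * T) X p.
Hypothesis X0 : {ae P, forall w, X 0 w = x0}.
Hypothesis pM : forall s x, t0 <= s <= T -> p s x0 x <= M.
Variables (N : nat) (Xi : 'I_N -> R -> {RV P >-> R}).
Hypothesis N0 : (0 < N)%N.
Hypothesis Xind : independent P (fun i => natural_filtration (Xi i) (2 * T)).
Hypothesis Xlaw : forall i, same_law (2 * T) (Xi i) X.
Variable Om0 : set Om.
Hypothesis mOm0 : measurable Om0.
Hypothesis POm0 : P (~` Om0) = 0%E.
Hypothesis cX : forall w, Om0 w ->
  forall i, {within `[0, 2 * T], continuous (fun t => Xi i t w)}.

Let T0 : 0 < T. Proof. by case/andP: t0T; apply: lt_trans. Qed.
Let TT0 : 0 < 2 * T. Proof. by rewrite mulr_gt0. Qed.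
Let L := T - t0.
Let L0 : 0 < L. Proof. by rewrite subr_gt0; case/andP: t0T. Qed.
Let D : set Rm := `[t0, T]%classic.
Let mD : measurable D. Proof. exact: measurable_itv. Qed.
Let muD : mu D = L%:E.
Proof. by rewrite /D lebesgue_measure_itv/= lte_fin; case/andP: t0T => _ ->. Qed.
Let Doo : (mu D < +oo)%E. Proof. by rewrite muD ltry. Qed.

(** Lebesgue measure carried by [t0, T], seen as a finite measure on the whole line so that time
    integrals range over [setT]. *)
Definition time_measure : {finite_measure set Rm -> \bar R} := mfrestr mD Doo.
Let lam := time_measure.

Let lamT : lam setT = L%:E.
Proof. by rewrite /lam/= /mfrestr /mrestr setTI muD. Qed.
Let lamD : lam (~` D) = 0%E.
Proof. by rewrite /lam/= /mfrestr /mrestr setICl measure0. Qed.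

Lemma time_measureE (g : Rm -> \bar R) : measurable_fun setT g ->
  (\int[time_measure]_s g s = \int[mu]_(s in `[t0, T]) g s)%E.
Proof. by move=> mg; rewrite -(integral_mrestr _ mD mg). Qed.

Let f := averaged_density p x0 T t0.

(* The indicator makes the transition density measurable on the whole line of
   times; it equals 1 on [D]. *)
Let r1 (z : Rm * Rm) : R := p z.1 x0 z.2 * \1_(`]0, 2 * T]%classic : set R) z.1.

Let mr1 : measurable_fun setT r1.
Proof.
rewrite (_ : r1 = (fun z : R * R * R =>
  (p z.1.1 z.1.2 z.2 * \1_(`]0, 2 * T]%classic : set R) z.1.1)) \o
   (fun z : Rm * Rm => (z.1, x0, z.2))); last by [].
apply: measurableT_comp (measurable_transition hp) _.
apply: measurable_fun_pair => //; apply: measurable_fun_pair => //.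
Qed.

Let r10 z : 0 <= r1 z.
Proof.
rewrite /r1 indicE; have [/[!inE]/= zS|_] := boolP (_ \in _); last by rewrite mulr0.
by rewrite mulr1 (td_ge0 hp)//; move: zS; rewrite in_itv.
Qed.

Let DS s : D s -> 0 < s <= 2 * T.
Proof.
rewrite /D/= in_itv/= => /andP[t0s sT]; have /andP[t00 _] := t0T.
by rewrite (lt_le_trans t00)//=; move: T0; lra.
Qed.

Let r1D s x : D s -> r1 (s, x) = p s x0 x.
Proof. by move=> /DS sS; rewrite /r1/= indicE mem_set ?mulr1//= in_itv. Qed.

Let r1int x : (\int[lam]_s (r1 (s, x))%:E = \int[mu]_(s in `[t0, T]) (p s x0 x)%:E)%E.
Proof.
rewrite time_measureE; last first.
  by apply/measurable_EFinP; exact: measurableT_comp mr1 (pair2_measurable x).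
by apply: eq_integral => s /[!inE] sD; rewrite r1D.
Qed.

(** The bound [M] on [t0, T] makes this integral finite, so that the [fine] hidden in
    [averaged_density] loses nothing. *)
Let r1fin x : (\int[lam]_s (r1 (s, x))%:E)%E \is a fin_num.
Proof.
rewrite ge0_fin_numE; last by apply: integral_ge0 => s _; rewrite lee_fin.
rewrite r1int; apply: (@le_lt_trans _ _ (\int[mu]_(s in `[t0, T]) (cst M%:E s))%E).
  apply: le_lower_integral => s; rewrite /= in_itv/= => sD.
  by rewrite !lee_fin pM// (td_ge0 hp)// DS//= /D/= in_itv.
by rewrite integral_cst// -[X in (_ * X < _)%E]/(mu D) muD -EFinM ltry.
Qed.

Lemma averaged_densityE x :
  (\int[time_measure]_s (r1 (s, x))%:E)%E = (L * f x)%:E.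
Proof.
rewrite -[LHS]fineK//; congr EFin.
rewrite /f /averaged_density -/L mulrA divff ?mul1r; last exact: lt0r_neq0.
by rewrite r1int.
Qed.

Lemma averaged_density_ge0 x : 0 <= f x.
Proof.
rewrite -(pmulr_rge0 _ L0) -lee_fin -averaged_densityE.
by apply: integral_ge0 => s _; rewrite lee_fin.
Qed.

Lemma measurable_averaged_density : measurable_fun setT f.
Proof.
rewrite (_ : f = fun x => L^-1 * fine (\int[lam]_s (r1 (s, x))%:E)%E); last first.
  by apply/funext => x; rewrite averaged_densityE/= mulKf// lt0r_neq0.
apply: measurable_funM => //; apply: measurableT_comp => //.
apply: (@measurable_fun_fubini_tonelli_G _ _ Rm Rm R lam (EFin \o r1)) => //.
  exact/measurable_EFinP.
Qed.

Let cl (s : R) := clamp (2 * T) s.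
(* A jointly measurable version of the paths. *)
Let Z i (z : Rm * Om) : R := Xi i (cl z.1) z.2 * \1_Om0 z.2.

Let mZ i : measurable_fun setT (Z i).
Proof.
apply: (measurable_joint TT0 (fun t => measurable_funPT (Xi i t)) mOm0).
by move=> w /cX /(_ i).
Qed.

Let U i (z : Rm * Om) : Rm * Rm := (Z i z, Z i (z.1 + t, z.2)).

Let mU i : measurable_fun setT (U i).
Proof.
apply: measurable_fun_pair; first exact: mZ.
apply: measurableT_comp (mZ i) _; apply: measurable_fun_pair => //.
by apply: measurable_funD.
Qed.

Let Ugood i s w : Om0 w -> U i (s, w) = (Xi i (cl s) w, Xi i (cl (s + t)) w).
Proof. by move=> Ow; rewrite /U /Z/= indicE mem_set// !mulr1. Qed.

(** Clamping is harmless on [D], since [s] and [t] are both at most [T] and the paths live on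
    [0, 2T]. *)
Let clD s : D s -> cl s = s /\ cl (s + t) = s + t.
Proof.
move=> Ds; have /andP[s0 sS] := DS Ds; have /andP[t00 tT'] := tT.
move: Ds; rewrite /D/= in_itv/= => /andP[t0s sT].
by split; apply: clamp_id; apply/andP; split; lra.
Qed.

Lemma path_pairE i s w : Om0 w -> D s -> U i (s, w) = (Xi i s w, Xi i (s + t) w).
Proof. by move=> Ow /clD[e1 e2]; rewrite Ugood// e1 e2. Qed.

Let ge0_integral_good (g h : Om -> \bar R) :
  measurable_fun setT g -> measurable_fun setT h ->
  (forall w, 0 <= g w)%E -> (forall w, 0 <= h w)%E ->
  (forall w, Om0 w -> g w = h w) -> (\int[P]_w g w = \int[P]_w h w)%E.
Proof.
move=> mg mh g0 h0 gh; apply: ge0_ae_eq_integral => //.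
exists (~` Om0); split => //; first exact: measurableC.
by move=> w /=; apply: contra_not => Ow _; exact: gh.
Qed.

Let mpair i a b : measurable_fun setT (fun w => ((Xi i a w, Xi i b w) : Rm * Rm)).
Proof.
by apply: measurable_fun_pair;
  [exact: (measurable_funPT (Xi i a))|exact: (measurable_funPT (Xi i b))].
Qed.

Let mUs i s : measurable_fun setT (fun w => U i (s, w)).
Proof. exact: measurableT_comp (mU i) (pair1_measurable s). Qed.

(** Clamped times always lie in [0, 2T], so the factorization holds for all real [s] and [s'], as
    the product of time integrals requires. *)
Let ind i j : i != j -> forall g h : Rm * Rm -> \bar R,
  measurable_fun setT g -> measurable_fun setT h ->
  (forall z, 0 <= g z)%E -> (forall z, 0 <= h z)%E -> forall s s',
  (\int[P]_w (g (U i (s, w)) * h (U j (s', w))) =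
  \int[P]_w g (U i (s, w)) * \int[P]_w h (U j (s', w)))%E.
Proof.
move=> ij g h mg mh g0 h0 s s'.
have E k (k' : Rm * Rm -> \bar R) s0 : measurable_fun setT k' -> (forall z, 0 <= k' z)%E ->
    (\int[P]_w k' (U k (s0, w)) = \int[P]_w k' (Xi k (cl s0) w, Xi k (cl (s0 + t)) w))%E.
  move=> mk k0; apply: ge0_integral_good => //.
  - exact: measurableT_comp mk (mUs k s0).
  - exact: measurableT_comp mk (mpair k _ _).
  - by move=> w Ow; rewrite Ugood.
rewrite !E//.
rewrite -(ge0_integral_indep_pair Xind ij) ?clamp_itv//.
apply: ge0_integral_good => //.
- apply: emeasurable_funM; [exact: measurableT_comp mg (mUs i s)|
    exact: measurableT_comp mh (mUs j s')].
- apply: emeasurable_funM; [exact: measurableT_comp mg (mpair i _ _)|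
    exact: measurableT_comp mh (mpair j _ _)].
- by move=> w; rewrite mule_ge0.
- by move=> w; rewrite mule_ge0.
- by move=> w Ow; rewrite !Ugood.
Qed.

Let rho (z : Rm * Rm) : R := joint_density f p t z.1 z.2.
Let tS : 0 < t <= 2 * T.
Proof. by have /andP[-> /=] := tT; move: T0; lra. Qed.
Let mrho : measurable_fun setT rho.
Proof.
apply: measurable_funM; last exact: (measurable_transition_t hp tS).
exact: measurableT_comp measurable_averaged_density measurable_fst.
Qed.
Let rho0 z : 0 <= rho z.
Proof. by rewrite mulr_ge0 ?averaged_density_ge0 ?(td_ge0 hp). Qed.

Let occ i (g : Rm * Rm -> \bar R) : measurable_fun setT g ->
  (forall z, 0 <= g z)%E ->
  (\int[P]_w \int[lam]_s g (U i (s, w)) =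
  L%:E * \int[mu \x mu]_z (g z * (rho z)%:E))%E.
Proof.
move=> mg g0.
(* For [s] in [D] this is the density of the pair of positions at times [s] and [s + t]; integrating
   over [s] affects only the first factor and yields [L * f]. *)
pose r (z : Rm * (Rm * Rm)) := r1 (z.1, z.2.1) * p t z.2.1 z.2.2.
refine (@occupation_formula _ _ _ Om Rm (Rm * Rm)%type R P lam (lebesgue2 R)
   (U i) r rho D L (mU i) _ _ _ _ _ _ _ _ g mg g0 _) => //.
- apply: measurable_funM.
    apply: measurableT_comp mr1 _; apply: measurable_fun_pair => //=.
    exact: measurableT_comp measurable_fst measurable_snd.
  exact: measurableT_comp (measurable_transition_t hp tS) measurable_snd.
- by move=> z; rewrite mulr_ge0// (td_ge0 hp).
- exact: ltW.
- move=> z; rewrite /r/=.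
  under eq_integral do rewrite EFinM.
  rewrite ge0_integralZr//.
  + by rewrite averaged_densityE -EFinM -mulrA.
  + by apply/measurable_EFinP; exact: measurableT_comp mr1 (pair2_measurable _).
  + by move=> s _; rewrite lee_fin.
  + by rewrite lee_fin (td_ge0 hp).
- move=> s Ds; have /andP[s0 sS] := DS Ds.
  have stS : s + t <= 2 * T.
    by move: Ds; rewrite /D/= in_itv/= => /andP[_ sT]; case/andP: tT => _; lra.
  have t00 : 0 < t by case/andP: tT.
  transitivity (\int[P]_w g (Xi i s w, Xi i (s + t) w))%E.
    apply: ge0_integral_good => //.
    + exact: measurableT_comp mg (mUs i s).
    + exact: measurableT_comp mg (mpair i _ _).
    + by move=> w Ow; rewrite path_pairE.
  rewrite (ge0_integral_pair_copy hp X0 (Xlaw i) s0 t00 stS mg g0).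
  by apply: eq_integral => z _; rewrite /r r1D.
Qed.

Let ind1 i j : i != j -> forall g h : Rm -> \bar R,
  measurable_fun setT g -> measurable_fun setT h ->
  (forall z, 0 <= g z)%E -> (forall z, 0 <= h z)%E -> forall s s',
  (\int[P]_w (g (Z i (s, w)) * h (Z j (s', w))) =
  \int[P]_w g (Z i (s, w)) * \int[P]_w h (Z j (s', w)))%E.
Proof.
move=> ij g h mg mh g0 h0 s s'.
have mg' : measurable_fun setT (g \o (fst : Rm * Rm -> Rm)).
  exact: measurableT_comp mg measurable_fst.
have mh' : measurable_fun setT (h \o (fst : Rm * Rm -> Rm)).
  exact: measurableT_comp mh measurable_fst.
exact: (ind ij mg' mh' (fun z => g0 z.1) (fun z => h0 z.1) s s').
Qed.

Let occ1 i (g : Rm -> \bar R) : measurable_fun setT g ->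
  (forall z, 0 <= g z)%E ->
  (\int[P]_w \int[lam]_s g (Z i (s, w)) =
  L%:E * \int[mu]_z (g z * (f z)%:E))%E.
Proof.
move=> mg g0.
refine (@occupation_formula _ _ _ Om Rm Rm R P lam mu (Z i) r1 f D L (mZ i) mr1
  r10 mD lamD (ltW L0) averaged_density_ge0 measurable_averaged_density
  averaged_densityE g mg g0 _).
move=> s Ds.
transitivity (\int[P]_w g (Xi i s w))%E.
    apply: ge0_integral_good => //.
    + exact: measurableT_comp mg (measurableT_comp (mZ i) (pair1_measurable s)).
    + exact: measurableT_comp mg (measurable_funPT (Xi i s)).
    + by move=> w Ow; have [] := path_pairE i Ow Ds => ->.
  rewrite (ge0_integral_marginal_copy hp X0 (Xlaw i) (DS Ds) mg g0).
  by apply: eq_integral => z _; rewrite r1D.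
Qed.

Section estimators.
Variable K : R -> R.
Hypothesis K2 : K \in Lfun mu 2%:E.
Hypothesis Ksym : forall x, K (- x) = K x.
Variables h1 h2 : R.
Hypothesis h10 : 0 < h1.
Hypothesis h20 : 0 < h2.

Let KhN h x : Kh K h (- x) = Kh K h x.
Proof. by rewrite /Kh mulNr Ksym. Qed.

Let mKh h : measurable_fun setT (Kh K h : Rm -> Rm).
Proof. exact: measurable_Kh. Qed.

Let mKhB h d' (A : measurableType d') (a b : A -> Rm) :
  measurable_fun setT a -> measurable_fun setT b ->
  measurable_fun setT (fun z => Kh K h (a z - b z)).
Proof. by move=> ma mb; apply: measurableT_comp (mKh h) _; exact: measurable_funB. Qed.

Lemma measurable_convolution_density :
  measurable_fun setT (fun x : Rm => convolution (Kh K h1) f x).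
Proof.
apply: (@measurable_fun_Rintegral _ _ Rm Rm R mu (fun z => Kh K h1 (z.1 - z.2) * f z.2)).
apply: measurable_funM; first exact: mKhB.
exact: measurableT_comp measurable_averaged_density measurable_snd.
Qed.

Lemma measurable_convolution_joint : measurable_fun setT (fun z : Rm * Rm =>
  convolution2 (Qh K h1 h2) (joint_density f p t) z.1 z.2).
Proof.
apply: (@measurable_fun_Rintegral _ _ (Rm * Rm)%type (Rm * Rm)%type R (lebesgue2 R)
  (fun z => Qh K h1 h2 (z.1.1 - z.2.1) (z.1.2 - z.2.2) * rho z.2)).
apply: measurable_funM; last exact: measurableT_comp mrho measurable_snd.
apply: measurable_funM; apply: mKhB.
- exact: measurableT_comp measurable_fst measurable_fst.
- exact: measurableT_comp measurable_fst measurable_snd.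
- exact: measurableT_comp measurable_snd measurable_fst.
- exact: measurableT_comp measurable_snd measurable_snd.
Qed.

(** The witness [sh] is the estimator computed from the jointly measurable paths; it agrees with
    [s_hat] on [Om0], where the losses are compared. *)
Lemma joint_estimator_variance : exists sh : Om * (Rm * Rm) -> R,
  [/\ measurable_fun setT sh,
    forall w, Om0 w -> forall z, s_hat Xi K T t0 h1 h2 t w z.1 z.2 = sh (w, z) &
    (\int[P]_w \int[mu \x mu]_z ((sh (w, z) -
       convolution2 (Qh K h1 h2) (joint_density f p t) z.1 z.2) ^+ 2)%R%:E <=
     (kernel_sqnorm K ^+ 2 / (h1 * h2) / N%:R)%:E)%E].
Proof.
pose q (x : (Rm * Rm) * (Rm * Rm)) := Qh K h1 h2 (x.2.1 - x.1.1) (x.2.2 - x.1.2).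
have mq : measurable_fun setT q.
  apply: measurable_funM; apply: mKhB.
  - exact: measurableT_comp measurable_fst measurable_snd.
  - exact: measurableT_comp measurable_fst measurable_fst.
  - exact: measurableT_comp measurable_snd measurable_snd.
  - exact: measurableT_comp measurable_snd measurable_fst.
have mqU i : measurable_fun setT (fun z : (Om * (Rm * Rm)) * Rm => q (z.1.2, U i (z.2, z.1.1))).
  apply: measurableT_comp mq _; apply: measurable_fun_pair => /=.
    exact: measurableT_comp measurable_snd measurable_fst.
  apply: measurableT_comp (mU i) _; apply: measurable_fun_pair => /=.
    exact: measurable_snd.
  exact: measurableT_comp measurable_fst measurable_fst.
exists (fun a => (N%:R * L)^-1 * \sum_i \int[lam]_s q (a.2, U i (s, a.1))); split.
- apply: measurable_funM => //; apply: measurable_sum => i.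
  exact: (@measurable_fun_Rintegral _ _ (Om * (Rm * Rm))%type Rm R lam _ (mqU i)).
- move=> w Ow z; rewrite /s_hat; congr (_ * _); apply: eq_bigr => i _.
  rewrite /Rintegral time_measureE; last first.
    by apply/measurable_EFinP; exact: measurableT_comp (mqU i) (pair1_measurable (w, z)).
  by congr fine; apply: eq_integral => s /[!inE] Ds; rewrite path_pairE.
have qC (z : Rm * Rm) : (\int[lebesgue2 R]_x (q (x, z) ^+ 2)%:E <=
    (kernel_sqnorm K ^+ 2 / (h1 * h2))%:E)%E.
  by rewrite -(sqr_norm_Qh K2 z.1 z.2 h10 h20).
have := @occupation_estimator_variance _ _ _ _ Om Rm (Rm * Rm)%type (Rm * Rm)%type R P lam
  L L0 lamT (lebesgue2 R) rho mrho rho0 N U N0 mU occ ind (lebesgue2 R) q _ mq qC.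
apply: le_trans; rewrite le_eqVlt; apply/orP; left; apply/eqP.
apply: eq_integral => w _; apply: eq_integral => z _; congr ((_ - _) ^+ 2)%R%:E.
(* The variance is centred at the integral of the kernel at [y - z], the convolution uses [z - y]:
   the symmetry of [K] identifies them. *)
rewrite /convolution2; congr fine; apply: eq_integral => y _.
by rewrite /q /Qh /= -(KhN h1) -(KhN h2) !opprB.
Qed.

Lemma marginal_estimator_variance : exists fh : Om * Rm -> R,
  [/\ measurable_fun setT fh,
    forall w, Om0 w -> forall x, f_hat Xi K T t0 h1 w x = fh (w, x) &
    (\int[P]_w \int[mu]_x ((fh (w, x) - convolution (Kh K h1) f x) ^+ 2)%R%:E <=
     (kernel_sqnorm K / h1 / N%:R)%:E)%E].
Proof.
pose q (x : Rm * Rm) := Kh K h1 (x.2 - x.1).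
have mq : measurable_fun setT q by exact: mKhB.
have mqU i : measurable_fun setT (fun z : (Om * Rm) * Rm => q (z.1.2, Z i (z.2, z.1.1))).
  apply: measurableT_comp mq _; apply: measurable_fun_pair => /=.
    exact: measurableT_comp measurable_snd measurable_fst.
  apply: measurableT_comp (mZ i) _; apply: measurable_fun_pair => /=.
    exact: measurable_snd.
  exact: measurableT_comp measurable_fst measurable_fst.
exists (fun a => (N%:R * L)^-1 * \sum_i \int[lam]_s q (a.2, Z i (s, a.1))); split.
- apply: measurable_funM => //; apply: measurable_sum => i.
  exact: (@measurable_fun_Rintegral _ _ (Om * Rm)%type Rm R lam _ (mqU i)).
- move=> w Ow z; rewrite /f_hat; congr (_ * _); apply: eq_bigr => i _.
  rewrite /Rintegral time_measureE; last first.
    by apply/measurable_EFinP; exact: measurableT_comp (mqU i) (pair1_measurable (w, z)).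
  congr fine; apply: eq_integral => s /[!inE] Ds.
  by have [-> _] := path_pairE i Ow Ds.
have qC (z : Rm) : (\int[mu]_x (q (x, z) ^+ 2)%:E <= (kernel_sqnorm K / h1)%:E)%E.
  by rewrite -(sqr_norm_Kh K2 z h10).
have := @occupation_estimator_variance _ _ _ _ Om Rm Rm Rm R P lam
  L L0 lamT mu f measurable_averaged_density averaged_density_ge0 N Z N0 mZ occ1 ind1
  mu q _ mq qC.
apply: le_trans; rewrite le_eqVlt; apply/orP; left; apply/eqP.
apply: eq_integral => w _; apply: eq_integral => z _; congr ((_ - _) ^+ 2)%R%:E.
rewrite /convolution; congr fine; apply: eq_integral => y _.
by rewrite /q /= -(KhN h1) !opprB.
Qed.

End estimators.

End diffusion_occupation.

(** * Risk bounds *)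

Section risk.
Context (R : realType).
Local Notation mu := (@lebesgue_measure R).
Local Notation Rm := (measurableTypeR R).

(** The centres [a] and [b] are arbitrary; they become [s_h] and [f_l]. Below the threshold the
    estimate is 0 and the error is [p], while [m / 2 <= f - fh]; splitting around [b] then costs
    only a factor 8. Above it the error is [(sh - p * fh) / fh], whose denominator is larger than
    [m / 2]. *)
Lemma thresholded_ratio_error (m f p s fh sh a b : R) : 0 < m -> m < f ->
  s = f * p ->
  (sh / fh * (m / 2 < fh)%R%:R - p) ^+ 2 <=
  16 / m ^+ 2 * ((sh - a) ^+ 2 + (a - s) ^+ 2 +
    p ^+ 2 * ((fh - b) ^+ 2 + (b - f) ^+ 2)).
Proof.
move=> m0 mf ->.
have m2 : 0 < m ^+ 2 by rewrite exprn_gt0.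
rewrite [leRHS]mulrAC ler_pdivlMr//.
case: ltP => [fhm|fhm]; last first.
  rewrite mulr0 sub0r sqrrN.
  have h1 : m ^+ 2 <= 4 * (f - fh) ^+ 2.
    have -> : 4 * (f - fh) ^+ 2 = (2 * (f - fh)) ^+ 2 by ring.
    by rewrite lerXn2r// ?nnegrE; lra.
  have h2 : (f - fh) ^+ 2 <= 2 * ((fh - b) ^+ 2 + (b - f) ^+ 2).
    by have := sqr_ge0 (fh - b - (b - f)); rewrite !expr2; lra.
  have h3 : p ^+ 2 * m ^+ 2 <= p ^+ 2 * (8 * ((fh - b) ^+ 2 + (b - f) ^+ 2)).
    by apply: ler_wpM2l; [exact: sqr_ge0|lra].
  have := sqr_ge0 (sh - a); have := sqr_ge0 (a - f * p).
  have := mulr_ge0 (sqr_ge0 p) (addr_ge0 (sqr_ge0 (fh - b)) (sqr_ge0 (b - f))).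
  by lra.
have fh0 : 0 < fh by apply: lt_trans fhm; rewrite divr_gt0.
rewrite mulr1.
have -> : sh / fh - p = (sh - p * fh) / fh by field; exact: lt0r_neq0.
rewrite exprMn exprVn.
have h1 : m ^+ 2 / fh ^+ 2 <= 4.
  rewrite ler_pdivrMr ?exprn_gt0//.
  have -> : 4 * fh ^+ 2 = (2 * fh) ^+ 2 by ring.
  by rewrite lerXn2r// ?nnegrE; lra.
have -> : (sh - p * fh) ^+ 2 / fh ^+ 2 * m ^+ 2 = (sh - p * fh) ^+ 2 * (m ^+ 2 / fh ^+ 2).
  by rewrite mulrAC -mulrA.
apply: (@le_trans _ _ ((sh - p * fh) ^+ 2 * 4)); first by apply: ler_wpM2l; rewrite ?sqr_ge0.
(* Four-term Cauchy-Schwarz inequality, which together with [h1] gives the 16. *)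
pose u1 := sh - a; pose u2 := a - f * p; pose u3 := p * (f - b); pose u4 := p * (b - fh).
have -> : sh - p * fh = u1 + u2 + u3 + u4 by rewrite /u1 /u2 /u3 /u4; ring.
have -> : 16 * (u1 ^+ 2 + u2 ^+ 2 + p ^+ 2 * ((fh - b) ^+ 2 + (b - f) ^+ 2)) =
    16 * (u1 ^+ 2 + u2 ^+ 2 + u3 ^+ 2 + u4 ^+ 2) by rewrite /u3 /u4; ring.
have := sqr_ge0 (u1 - u2); have := sqr_ge0 (u1 - u3); have := sqr_ge0 (u1 - u4).
have := sqr_ge0 (u2 - u3); have := sqr_ge0 (u2 - u4); have := sqr_ge0 (u3 - u4).
by rewrite !expr2; lra.
Qed.

Context d (Om : measurableType d) (P : probability Om R).
Variables (sh : Om * (Rm * Rm) -> R) (fh : Om * Rm -> R).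
Variables (pt s_h : Rm * Rm -> R) (f f_l g : Rm -> R) (m l r M G : R).
Hypothesis m0 : 0 < m.
Hypothesis msh : measurable_fun setT sh.
Hypothesis mfh : measurable_fun setT fh.
Hypothesis mpt : measurable_fun setT pt.
Hypothesis ms_h : measurable_fun setT s_h.
Hypothesis mf : measurable_fun setT f.
Hypothesis mf_l : measurable_fun setT f_l.
Hypothesis mg : measurable_fun setT g.
Hypothesis g0 : forall y, 0 <= g y.
Hypothesis gG : forall y, g y <= G.
Hypothesis pt0 : forall z, 0 <= pt z.
Hypothesis ptM : forall z, pt z <= M.
Hypothesis pt1 : forall x, (\int[mu]_y (pt (x, y))%:E = 1)%E.
Hypothesis fm : forall x, l <= x <= r -> m < f x.
Local Open Scope ereal_scope.

Let s (z : Rm * Rm) : R := (f z.1 * pt z)%R.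
Let ms : measurable_fun setT s.
Proof. by apply: measurable_funM => //; exact: measurableT_comp mf measurable_fst. Qed.

Let G0 : (0 <= G)%R. Proof. exact: le_trans (g0 0%R) (gG 0%R). Qed.
Let M0 : (0 <= M)%R. Proof. exact: le_trans (pt0 (0, 0)%R) (ptM (0, 0)%R). Qed.

Let mg2 : measurable_fun setT (fun z : Rm * Rm => g z.2).
Proof. exact: measurableT_comp mg measurable_snd. Qed.

(** One factor [pt z] is bounded by [M]; the other is kept and integrates to 1 in the second
    variable, which is possible because [h] depends on the first one only. *)
Lemma weighted_transition_le (h : Rm -> R) : measurable_fun setT h ->
  (forall x, (0 <= h x)%R) ->
  \int[mu \x mu]_z (pt z ^+ 2 * h z.1 * g z.2)%:E <=
  (M * G)%:E * \int[mu]_x (h x)%:E.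
Proof.
move=> mh h0.
have mh1 : measurable_fun setT (fun z : Rm * Rm => h z.1).
  exact: measurableT_comp mh measurable_fst.
pose H (z : Rm * Rm) := (M * G * (h z.1 * pt z))%:E.
have mH : measurable_fun setT H.
  by apply/measurable_EFinP; apply: measurable_funM => //; exact: measurable_funM.
have H0 z : 0 <= H z by rewrite lee_fin !mulr_ge0.
apply: (@le_trans _ _ (\int[mu \x mu]_z H z)).
  apply: le_lower_integral => z _; rewrite !lee_fin !mulr_ge0//=.
  have -> : (M * G * (h z.1 * pt z) = pt z * M * h z.1 * G)%R by ring.
  apply: ler_pM => //; first by rewrite !mulr_ge0.
  by apply: ler_wpM2r => //; rewrite expr2; apply: ler_wpM2l.
rewrite (fubini_tonelli1 H)// /fubini_F /H /=.
rewrite -ge0_integralZl//; last 3 first.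
- exact/measurable_EFinP.
- by move=> x _; rewrite lee_fin.
- by rewrite lee_fin mulr_ge0.
rewrite le_eqVlt; apply/orP; left; apply/eqP; apply: eq_integral => x _.
under eq_integral do rewrite mulrA EFinM.
rewrite ge0_integralZl//; last 3 first.
- apply/measurable_EFinP; exact: measurableT_comp mpt (pair1_measurable x).
- by move=> y _; rewrite lee_fin.
- by rewrite lee_fin !mulr_ge0.
by rewrite pt1 mule1 EFinM.
Qed.

Let c : R := (16 / m ^+ 2)%R.
Let c0 : (0 <= c)%R. Proof. by rewrite divr_ge0// sqr_ge0. Qed.

Let IA w := \int[mu \x mu]_z ((sh (w, z) - s_h z) ^+ 2)%R%:E.
Let IC w := \int[mu]_x ((fh (w, x) - f_l x) ^+ 2)%R%:E.
Let IB := \int[mu \x mu]_z ((s_h z - s z) ^+ 2 * g z.2)%R%:E.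
Let ID := \int[mu]_x ((f_l x - f x) ^+ 2)%R%:E.

Let Phi w := c%:E * (G%:E * IA w + IB + (M * G)%:E * (IC w + ID)).

Lemma weighted_loss_le w :
  \int[mu \x mu]_(z in `[l, r] `*` setT)
    ((sh (w, z) / fh (w, z.1) * (m / 2 < fh (w, z.1))%R%:R - pt z) ^+ 2 * g z.2)%R%:E
  <= Phi w.
Proof.
have mshw : measurable_fun setT (fun z => sh (w, z)).
  exact: measurableT_comp msh (pair1_measurable w).
have mfhw : measurable_fun setT (fun z => fh (w, z)).
  exact: measurableT_comp mfh (pair1_measurable w).
pose A (z : Rm * Rm) := ((sh (w, z) - s_h z) ^+ 2 * g z.2)%R%:E.
pose B (z : Rm * Rm) := ((s_h z - s z) ^+ 2 * g z.2)%R%:E.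
pose hC (x : Rm) := ((fh (w, x) - f_l x) ^+ 2)%R.
pose hD (x : Rm) := ((f_l x - f x) ^+ 2)%R.
pose h x := (hC x + hD x)%R.
pose C (z : Rm * Rm) := (pt z ^+ 2 * h z.1 * g z.2)%:E.
have mA : measurable_fun setT A.
  apply/measurable_EFinP; apply: measurable_funM => //; apply: measurable_funX.
  exact: measurable_funB.
have mB : measurable_fun setT B.
  apply/measurable_EFinP; apply: measurable_funM => //; apply: measurable_funX.
  exact: measurable_funB.
have mhC : measurable_fun setT hC by apply: measurable_funX; exact: measurable_funB.
have mhD : measurable_fun setT hD by apply: measurable_funX; exact: measurable_funB.
have mh : measurable_fun setT h by exact: measurable_funD.
have h0 x : (0 <= h x)%R by rewrite addr_ge0 ?sqr_ge0.
have mC : measurable_fun setT C.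
  apply/measurable_EFinP; apply: measurable_funM => //; apply: measurable_funM.
    exact: measurable_funX.
  exact: measurableT_comp mh measurable_fst.
have A0 z : 0 <= A z by rewrite lee_fin mulr_ge0 ?sqr_ge0.
have B0 z : 0 <= B z by rewrite lee_fin mulr_ge0 ?sqr_ge0.
have C0 z : 0 <= C z by rewrite lee_fin !mulr_ge0 ?sqr_ge0.
apply: (@le_trans _ _ (\int[mu \x mu]_z (c%:E * (A z + B z + C z)))).
  (* The comparison is made on the whole plane: off the strip, where [f] has no lower bound, the
     left integrand is 0. *)
  rewrite integral_mkcond; apply: le_lower_integral => z _.
  rewrite patchE; case: ifPn => [|_]; last first.
    by rewrite lexx/=; apply: mule_ge0; [rewrite lee_fin|rewrite !adde_ge0].
  rewrite inE => -[/= zlr _]; rewrite in_itv/= in zlr.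
  rewrite /A /B /C -!EFinD -EFinM !lee_fin mulr_ge0 ?sqr_ge0//=.
  have -> : ((sh (w, z) - s_h z) ^+ 2 * g z.2 + (s_h z - s z) ^+ 2 * g z.2 +
      pt z ^+ 2 * h z.1 * g z.2 = ((sh (w, z) - s_h z) ^+ 2 + (s_h z - s z) ^+ 2 +
      pt z ^+ 2 * h z.1) * g z.2)%R by ring.
  rewrite mulrA; apply: ler_wpM2r => //.
  exact: (thresholded_ratio_error _ _ _ _ m0 (fm zlr)).
rewrite ge0_integralZl//; last 2 first.
- by apply: emeasurable_funD => //; exact: emeasurable_funD.
- by move=> z _; rewrite !adde_ge0.
rewrite ge0_integralD//; last 2 first.
- by move=> z _; rewrite adde_ge0.
- exact: emeasurable_funD.
rewrite ge0_integralD//; apply: lee_wpmul2l; first by rewrite lee_fin.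
apply: leeD; first apply: leeD => //.
  rewrite /IA -ge0_integralZl//; last 2 first.
  - by apply/measurable_EFinP; apply: measurable_funX; exact: measurable_funB.
  - by move=> z _; rewrite lee_fin sqr_ge0.
  apply: le_lower_integral => z _; rewrite A0/= /A -EFinM lee_fin mulrC.
  by apply: ler_wpM2r; rewrite ?sqr_ge0.
apply: le_trans (weighted_transition_le mh h0) _.
apply: lee_wpmul2l; first by rewrite lee_fin mulr_ge0.
rewrite /h; under eq_integral do rewrite EFinD.
rewrite ge0_integralD//.
- by move=> x _; rewrite lee_fin sqr_ge0.
- exact/measurable_EFinP.
- by move=> x _; rewrite lee_fin sqr_ge0.
- exact/measurable_EFinP.
Qed.

Variables (Om0 : set Om) (E1 E2 : R) (loss : Om -> \bar R).
Hypothesis mOm0 : measurable Om0.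
Hypothesis POm0 : P (~` Om0) = 0.
Hypothesis loss0 : forall w, 0 <= loss w.
Hypothesis lossE : forall w, Om0 w -> loss w = \int[mu \x mu]_(z in `[l, r] `*` setT)
  ((sh (w, z) / fh (w, z.1) * (m / 2 < fh (w, z.1))%R%:R - pt z) ^+ 2 * g z.2)%R%:E.
Hypothesis vars : \int[P]_w IA w <= E1%:E.
Hypothesis varf : \int[P]_w IC w <= E2%:E.

(** The function [loss] is tied to the measurable versions on [Om0] only and may fail to be
    measurable, so its expectation is compared with that of [Phi] through [ae_le_lower_integral]. *)
Lemma weighted_risk_le :
  \int[P]_w loss w <= c%:E * (G%:E * E1%:E + IB + (M * G)%:E * (E2%:E + ID)).
Proof.
have mIA : measurable_fun setT IA.
  pose F (z : Om * (Rm * Rm)) := ((sh z - s_h z.2) ^+ 2)%R%:E.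
  apply: (@measurable_fun_fubini_tonelli_F _ _ Om (Rm * Rm)%type R (lebesgue2 R) F).
    apply/measurable_EFinP; apply: measurable_funX; apply: measurable_funB => //.
    exact: measurableT_comp ms_h measurable_snd.
  by move=> z; rewrite lee_fin sqr_ge0.
have mIC : measurable_fun setT IC.
  pose F (z : Om * Rm) := ((fh z - f_l z.2) ^+ 2)%R%:E.
  apply: (@measurable_fun_fubini_tonelli_F _ _ Om Rm R mu F).
    apply/measurable_EFinP; apply: measurable_funX; apply: measurable_funB => //.
    exact: measurableT_comp mf_l measurable_snd.
  by move=> z; rewrite lee_fin sqr_ge0.
have IA0 w : 0 <= IA w by apply: integral_ge0 => z _; rewrite lee_fin sqr_ge0.
have IC0 w : 0 <= IC w by apply: integral_ge0 => z _; rewrite lee_fin sqr_ge0.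
have IB0 : 0 <= IB by apply: integral_ge0 => z _; rewrite lee_fin mulr_ge0// sqr_ge0.
have ID0 : 0 <= ID by apply: integral_ge0 => z _; rewrite lee_fin sqr_ge0.
have MG0 : 0 <= (M * G)%:E by rewrite lee_fin mulr_ge0.
have m1 : measurable_fun setT (fun w => G%:E * IA w + IB).
  by apply: emeasurable_funD => //; exact: measurable_funeM.
have m2 : measurable_fun setT (fun w => (M * G)%:E * (IC w + ID)).
  by apply: measurable_funeM; exact: emeasurable_funD.
have m3 : measurable_fun setT (fun w => G%:E * IA w + IB + (M * G)%:E * (IC w + ID)).
  exact: emeasurable_funD.
have p1 w : 0 <= G%:E * IA w + IB by rewrite adde_ge0// mule_ge0// lee_fin.
have p2 w : 0 <= (M * G)%:E * (IC w + ID) by rewrite mule_ge0// adde_ge0.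
apply: (@le_trans _ _ (\int[P]_w Phi w)).
  apply: (@ae_le_lower_integral _ _ _ P (~` Om0)) => //.
  - exact: measurableC.
  - exact: measurable_funeM.
  - by move=> w; rewrite mule_ge0 ?lee_fin// adde_ge0.
  - move=> w /=; rewrite -[X in X -> _]/((~` ~` Om0) w) setCK => Ow.
    by rewrite lossE//; exact: weighted_loss_le.
rewrite /Phi ge0_integralZl//; last by move=> w _; rewrite adde_ge0.
apply: lee_wpmul2l; first by rewrite lee_fin.
have P1 (k : \bar R) : \int[P]_w (cst k w) = k.
  by rewrite integral_cst// [X in _ * X]probability_setT mule1.
rewrite ge0_integralD//; apply: leeD.
  rewrite ge0_integralD//; last 2 first.
  - by move=> w _; rewrite mule_ge0// lee_fin.
  - exact: measurable_funeM.
  rewrite ge0_integralZl//.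
  rewrite -[X in _ + X]/(\int[P]_w (cst IB w)) P1.
  by apply: leeD => //; apply: lee_wpmul2l => //; rewrite lee_fin.
rewrite ge0_integralZl//; last 2 first.
- exact: emeasurable_funD.
- by move=> w _; rewrite adde_ge0.
apply: lee_wpmul2l => //.
rewrite ge0_integralD//.
rewrite -[X in _ + X]/(\int[P]_w (cst ID w)) P1.
exact: leeD.
Qed.

End risk.

(** The coefficients [G] and [M * G] are both at most [mx * G]. The last hypothesis does the same
    for the bias term, [b] being the form in which it is produced and [a] the form in which it is
    announced. *)
Lemma risk_bound_rearrange (R : realType) (c G M mx : R) (e1 e2 a b D : \bar R) :
  0 <= c -> 0 <= G -> 0 <= M -> M <= mx -> 1 <= mx ->
  (0 <= e1)%E -> (0 <= e2)%E -> (0 <= a)%E -> (0 <= D)%E ->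
  (b <= (mx * G)%:E * a)%E ->
  (c%:E * (G%:E * e1 + b + (M * G)%:E * (e2 + D)) <=
   (c * mx * G)%:E * (a + D + e1 + e2))%E.
Proof.
move=> c0 G0 M0 Mmx mx1 e10 e20 a0 D0 ba.
have k0 : (0 <= (mx * G)%:E :> \bar R)%E by rewrite lee_fin mulr_ge0// (le_trans _ mx1).
have Gk : (G%:E <= (mx * G)%:E :> \bar R)%E by rewrite lee_fin ler_peMl.
have MGk : ((M * G)%:E <= (mx * G)%:E :> \bar R)%E by rewrite lee_fin ler_wpM2r.
rewrite -[in leRHS]mulrA [in leRHS]EFinM -muleA; apply: lee_wpmul2l => //.
have -> : (a + D + e1 + e2 = e1 + a + (e2 + D))%E.
  by rewrite [in RHS](addeC e1) -!addeA; congr (_ + _)%E; rewrite addeCA (addeC D) addeA.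
rewrite !ge0_muleDr ?adde_ge0//; apply: leeD; first apply: leeD => //.
- exact: lee_wpmul2r.
- by apply: leeD; apply: lee_wpmul2r.
Qed.

Lemma kernel_norm_powers (R : realType) (K : R -> R) :
  K \in Lfun (@lebesgue_measure R) 2%:E ->
  (norm_R K ^+ 2 = (kernel_sqnorm K)%:E)%E /\ (norm_R K ^+ 4 = (kernel_sqnorm K ^+ 2)%:E)%E.
Proof.
move=> K2; have e2 : (norm_R K ^+ 2 = (kernel_sqnorm K)%:E)%E.
  by rewrite /norm_R sqr_Lnorm2 kernel_sqnormE.
split => //; move: e2; have := Lnorm_ge0 (@lebesgue_measure R) 2 (EFin \o K).
rewrite -/(norm_R K); case: (norm_R K) => [x| |].
- by move=> _; rewrite -!EFin_expe => -[<-]; rewrite -exprM.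
- by rewrite expe2 mulyy.
- by [].
Qed.

Unset Implicit Arguments.
Set Strict Implicit.

Theorem corollary1
  (R : realType) (d : measure_display) (Omega : measurableType d)
  (P : probability Omega R)
  (T x0 : R) (b sigma : R -> R) (alpha A : R)
  (hT : 0 < T)
  (hb : C1_bounded_derivative b) (hsigma : C1_bounded_derivative sigma)
  (halpha : 0 < alpha) (hA : 0 < A)
  (hsigma_bounds : forall x, alpha <= `|sigma x| <= alpha + A)
  (W X : R -> {RV P >-> R})
  (hW : brownian_motion (2 * T) W)
  (hX : strong_solution b sigma x0 (2 * T) W X)
  (p : R -> R -> R -> R)
  (hp : markov_transition_density (2 * T) X p)
  (cbar c : R) (hc : density_bounds p x0 T cbar c)
  (N : nat) (hN : (0 < N)%N)
  (Wi Xi : 'I_N -> R -> {RV P >-> R})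
  (hcopies : independent_copies b sigma x0 (2 * T) X Wi Xi)
  (t0 : R) (ht0 : 0 < t0 < T)
  (m l r : R) (hm : 0 < m <= 1) (hlr : l < r)
  (hf : forall x, l <= x <= r -> m < averaged_density p x0 T t0 x)
  (K : R -> R) (hK : kernel_function K)
  (hK2 : K \in Lfun (@lebesgue_measure R) 2%:E)
  (hKsym : forall x, K (- x) = K x)
  (t : R) (ht : 0 < t <= T)
  (h1 h2 ell : R) (hh1 : 0 < h1 <= 1) (hh2 : 0 < h2 <= 1)
  (hell : 0 < ell <= 1) :
  let f := averaged_density p x0 T t0 in
  let s := joint_density f p in
  let s_h := convolution2 (Qh K h1 h2) (s t) in
  let f_l := convolution (Kh K ell) f in
  let phat := p_hat Xi K m T t0 h1 h2 ell t in
  (\int[P]_w sqnorm_strip l r (fun x y => (phat w x y - p t x y)%R)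
    <= (16 / m ^+ 2 * Num.max 1 (m_p cbar (Num.min t0 t)))%:E *
       (norm_R2 (fun x y => (s_h x y - s t x y)%R) ^+ 2
        + norm_R (fun x => (f_l x - f x)%R) ^+ 2
        + norm_R K ^+ 4 * ((N%:R * h1 * h2)^-1)%:E
        + norm_R K ^+ 2 * ((N%:R * ell)^-1)%:E))%E
  /\
  (\int[P]_w sqnorm_weighted_strip f l r (fun x y => (phat w x y - p t x y)%R)
    <= (16 / m ^+ 2 * Num.max 1 (m_p cbar (Num.min t0 t)) * m_f c T t0)%:E *
       ((m^-1)%:E * sqnorm_weighted f (fun x y => (s_h x y - s t x y)%R)
        + norm_R (fun x => (f_l x - f x)%R) ^+ 2
        + norm_R K ^+ 4 * ((N%:R * h1 * h2)^-1)%:E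
        + norm_R K ^+ 2 * ((N%:R * ell)^-1)%:E))%E.
Proof.
move=> f s s_h f_l phat.
have /andP[t00 t0T] := ht0.
have /andP[tp tT] := ht.
have /andP[m0 m1] := hm.
have /andP[h10 _] := hh1.
have /andP[h20 _] := hh2.
have /andP[ell0 _] := hell.
set Mp := m_p cbar (Num.min t0 t); set mx := Num.max 1 Mp.
have pM s' x : t0 <= s' <= T -> p s' x0 x <= m_p cbar t0.
  by move=> s'T; apply: (db_p hc) => //.
have tS : 0 < t <= 2 * T by rewrite tp/=; lra.
have X0 := sol_start hX.
have Xc i := sol_continuous (ic_solution hcopies i).
have [Om0 [mOm0 POm0 cOm0]] := continuous_paths_set Xc.
have Xind := ic_independent hcopies.
have Xlaw := ic_same_law hcopies.
have [sh [msh shE vars]] := joint_estimator_variance ht0 ht hp X0 pM hN Xind Xlaw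
  mOm0 POm0 cOm0 hK2 hKsym h10 h20.
have [fh [mfh fhE varf]] := marginal_estimator_variance ht0 ht hp X0 pM hN Xind Xlaw
  mOm0 POm0 cOm0 hK2 hKsym ell0.
have mf : measurable_fun setT f := measurable_averaged_density ht0 hp pM.
have f0 : forall x, 0 <= f x := averaged_density_ge0 ht0 hp pM.
have ms_h := measurable_convolution_joint ht0 ht hp pM hK2 h1 h2.
have mf_l := measurable_convolution_density ht0 hp pM hK2 ell.
have mpt := measurable_transition_t hp tS.
have pt0 x y : 0 <= p t x y by rewrite (td_ge0 hp).
(* The bounds require an initial time strictly below [T]; the minimum satisfies this because [t0]
   does, even when [t = T]. *)
have ptM x y : p t x y <= Mp.
  apply: (db_p hc); last by rewrite ge_min lexx orbT.
  by rewrite lt_min t00 tp gt_min t0T.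
have pt1 x : (\int[@lebesgue_measure R]_y (p t x y)%:E = 1)%E := td_int1 hp x tS.
have Mp0 : 0 <= Mp := le_trans (pt0 0 0) (ptM 0 0).
have fG x : f x <= m_f c T t0.
  by apply: le_trans (ler_norm _) (db_f hc _ _); rewrite (ltW t00).
have mx1 : 1 <= mx by rewrite le_max lexx.
have Mpmx : Mp <= mx by rewrite le_max lexx orbT.
have c0 : 0 <= 16 / m ^+ 2 by rewrite divr_ge0// sqr_ge0.
have [K2E K4E] := kernel_norm_powers hK2.
have V1 : (norm_R K ^+ 4 * ((N%:R * h1 * h2)^-1)%:E =
    (kernel_sqnorm K ^+ 2 / (h1 * h2) / N%:R)%:E)%E.
  rewrite K4E -EFinM; congr EFin; field.
  by rewrite !lt0r_neq0// ltr0n.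
have V2 : (norm_R K ^+ 2 * ((N%:R * ell)^-1)%:E = (kernel_sqnorm K / ell / N%:R)%:E)%E.
  rewrite K2E -EFinM; congr EFin; field.
  by rewrite !lt0r_neq0// ltr0n.
have e10 : (0 <= (kernel_sqnorm K ^+ 2 / (h1 * h2) / N%:R)%:E :> \bar R)%E.
  by rewrite lee_fin divr_ge0// divr_ge0 ?sqr_ge0// mulr_ge0// ltW.
have e20 : (0 <= (kernel_sqnorm K / ell / N%:R)%:E :> \bar R)%E.
  rewrite -V2 mule_ge0//; last by rewrite lee_fin invr_ge0 mulr_ge0// ltW.
  by rewrite /norm_R sqr_Lnorm2; apply: integral_ge0 => x _; rewrite lee_fin sqr_ge0.
rewrite V1 V2.
have DE : (norm_R (fun x => (f_l x - f x)%R) ^+ 2 =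
    \int[@lebesgue_measure R]_x ((f_l x - f x) ^+ 2)%:E)%E by rewrite /norm_R sqr_Lnorm2.
have D0 : (0 <= norm_R (fun x => (f_l x - f x)%R) ^+ 2)%E.
  by rewrite DE; apply: integral_ge0 => x _; rewrite lee_fin sqr_ge0.
have loss0 (g : R -> R) w : (forall y, 0 <= g y) ->
    (0 <= \int[@lebesgue_measure R \x @lebesgue_measure R]_(z in `[l, r] `*` setT)
      ((phat w z.1 z.2 - p t z.1 z.2) ^+ 2 * g z.2)%:E)%E.
  by move=> g0; apply: integral_ge0 => z _; rewrite lee_fin mulr_ge0// sqr_ge0.
have lossE (g : R -> R) w : Om0 w ->
  (\int[@lebesgue_measure R \x @lebesgue_measure R]_(z in `[l, r] `*` setT)
      ((phat w z.1 z.2 - p t z.1 z.2) ^+ 2 * g z.2)%:E =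
   \int[@lebesgue_measure R \x @lebesgue_measure R]_(z in `[l, r] `*` setT)
      ((sh (w, z) / fh (w, z.1) * (m / 2 < fh (w, z.1))%R%:R - p t z.1 z.2) ^+ 2
        * g z.2)%:E)%E.
  by move=> Ow; apply: eq_integral => z _; rewrite /phat /p_hat shE// fhE.
have risk (g : R -> R) (G : R) := @weighted_risk_le R _ Omega P sh fh
  (fun z => p t z.1 z.2) (fun z => s_h z.1 z.2) f f_l g m l r Mp G m0 msh mfh mpt
  ms_h mf mf_l.
split.
- have -> : (\int[P]_w sqnorm_strip l r (fun x y => (phat w x y - p t x y)%R) =
    \int[P]_w \int[@lebesgue_measure R \x @lebesgue_measure R]_(z in `[l, r] `*` setT)
      ((phat w z.1 z.2 - p t z.1 z.2) ^+ 2 * cst 1 z.2)%:E)%E.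
    by apply: eq_integral => w _; apply: eq_integral => z _; rewrite mulr1.
  have := risk (cst 1) 1 (measurable_cst _) (fun=> ler01) (fun=> lexx 1)
    (fun z => pt0 z.1 z.2) (fun z => ptM z.1 z.2) pt1 hf Om0 _ _ _ mOm0 POm0
    (fun w => loss0 _ w (fun=> ler01)) (lossE (cst 1)) vars varf.
  have AE : (norm_R2 (fun x y => (s_h x y - s t x y)%R) ^+ 2 =
      \int[@lebesgue_measure R \x @lebesgue_measure R]_z
        ((s_h z.1 z.2 - s t z.1 z.2) ^+ 2)%:E)%E by rewrite /norm_R2 sqr_Lnorm2.
  have A0 : (0 <= norm_R2 (fun x y => (s_h x y - s t x y)%R) ^+ 2)%E.
    by rewrite AE; apply: integral_ge0 => z _; rewrite lee_fin sqr_ge0.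
  move=> /le_trans; apply; rewrite -[16 / m ^+ 2 * mx]mulr1 -DE.
  apply: risk_bound_rearrange => //.
  rewrite mulr1 -[leLHS]mul1e; apply: lee_pmul => //.
  + by apply: integral_ge0 => z _; rewrite lee_fin mulr1 sqr_ge0.
  + by rewrite AE; under eq_integral do rewrite mulr1.
- have := risk f (m_f c T t0) mf f0 fG
    (fun z => pt0 z.1 z.2) (fun z => ptM z.1 z.2) pt1 hf Om0 _ _ _ mOm0 POm0
    (fun w => loss0 _ w f0) (lossE f) vars varf.
  have B0 : (0 <= sqnorm_weighted f (fun x y => (s_h x y - s t x y)%R))%E.
    by apply: integral_ge0 => z _; rewrite lee_fin mulr_ge0 ?sqr_ge0.
  (* Evaluating [f] at [l] compares [m] with the bound on [f]. Hence [1 <= m_f / m], which lets the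
     common factor [m_f] be placed in front of the bias once it is divided by [m]. *)
  have Gm : m <= m_f c T t0.
    by apply: le_trans (fG l); apply: ltW; apply: hf; rewrite lexx ltW.
  have G0 : 0 <= m_f c T t0 by apply: le_trans Gm; exact: ltW.
  move=> /le_trans; apply; rewrite -DE.
  apply: risk_bound_rearrange => //.
  + by rewrite mule_ge0// lee_fin invr_ge0 ltW.
  + rewrite muleA -EFinM -[leLHS]mul1e; apply: lee_wpmul2r => //.
    rewrite lee_fin ler_pdivlMr// mul1r (le_trans Gm)//.
    by rewrite ler_peMl.
Qed.
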